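(* For $\pi(N)(1+o(1))$ primes $p\le N$ (as $N\to\infty$), every integer $\lambda$ can be written as $$F_{n_1}+\cdots+F_{n_{16}}\equiv\lambda\pmod p,$$ where $1\le n_1,\ldots,n_{16}\le N^{1/2+o(1)}$.
   Context: $\{F_n\}$ is the Fibonacci sequence: $F_1=F_2=1$, $F_{n+2}=F_{n+1}+F_n$ for $n\ge1$. $\pi(N)$ denotes the number of primes $p\le N$; $o(1)$ denotes quantities tending to $0$ as $N\to\infty$. *)

(* Defs.v *)
From HB Require Import structures.
From mathcomp Require Import all_boot all_order all_algebra.
From mathcomp Require Import all_classical all_reals all_analysis.
Set Implicit Arguments. Unset Strict Implicit. Unset Printing Implicit Defensive.
Import Order.TTheory GRing.Theory Num.Theory.
Local Open Scope ring_scope.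

Fixpoint fib (n : nat) : nat :=
  match n with
  | 0 => 0
  | 1 => 1
  | (m.+1 as k).+1 => (fib k + fib m)%N
  end.

Definition prime_pi (N : nat) : nat := #|[set p : 'I_N.+1 | prime p]|.

Definition good16 (R : realType) (p : nat) (B : R) : Prop :=
  forall lam : int, exists n : 'I_16 -> nat,
    (forall i, (1 <= n i)%N /\ (n i)%:R <= B) /\
    ((\sum_(i < 16) (fib (n i))%:Z)%R = lam %[mod (p%:Z)])%Z.

Definition good_count (R : realType) (N : nat) (B : R) : nat :=
  #|[set p : 'I_N.+1 | prime p && `[< good16 p B >] ]|.

(* Main.v *)
Require Import Defs.
From HB Require Import structures.
From mathcomp Require Import all_classical all_reals all_analysis.
From mathcomp Require Import all_boot all_order all_algebra.
From mathcomp Require Import finfield zify ring lra.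
Set Implicit Arguments. Unset Strict Implicit. Unset Printing Implicit Defensive.
Import Order.TTheory GRing.Theory Num.Theory.
Import numFieldNormedType.Exports.
Local Open Scope ring_scope.

(** For even n, F_m L_n = F_(m+n) + F_(m-n), so it is enough to write every
    residue as a sum of eight products F_m L_n.  By Glibichuk's theorem this is
    possible with indices O(sqrt N) as soon as these indices give about
    sqrt(2p) distinct residues, i.e. unless p divides some F_d with
    d <= D = O(sqrt N).  Such a d may be taken to divide p - 1 or p + 1.

    It remains to see that those exceptional p are a vanishing proportion of
    the primes up to N.  The p with d <= sqrt N / h divide a product of
    Fibonacci numbers too small to have many prime factors of size N.  For the
    others p - 1 or p + 1 equals d e with both factors of order sqrt N, and
    Erdos's multiplication table argument applies: for a finite set Q of primes
    with S = sum of 1/q large, a typical integer has about S prime factors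
    in Q, so de would have about 2S of them, which is atypical for p - 1 and
    p + 1.  All the counts of primes are upper bounds obtained from Selberg's
    sieve, to be compared with Chebyshev's lower bound for pi(N). *)

(** * Sums of eight products in a finite field *)

(** The middle range of d is the obstacle. Bounding the primes p = 1 or -1 modulo d by the sieve,
    one d at a time between sqrt N / h and a multiple of sqrt N, gives a total of order pi(N) log h:
    a positive proportion, so size alone cannot discard these primes. The saving comes from the
    number of prime factors in Q. The threshold 7S/10 for d and e becomes 14S/10 for d e, strictly
    between the typical value S and the value 2S that d e would have. Moments with ratio 3/4 for d,
    and 4/3 for p - 1 and p + 1, make both tails decay exponentially in S. The parameters are chosen
    in the order h, then Q, then N, so losses such as 2^|Q| are harmless. The level of the sieve is
    2^k with k about (log2 N)/100: every error term is then a small power of N. Bounded factors may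
    be lost everywhere, since the final bound carries an arbitrarily small factor; the numerical
    constants have no other significance. *)

Lemma card_sqr_le_collisions (T U : finType) (f : T -> U) (X : {set T}) :
  (#|X| ^ 2 <= #|f @: X| * \sum_(x in X) \sum_(y in X) (f x == f y))%N.
Proof.
(* Cauchy-Schwarz on the sizes [c u] of the fibres: they sum to |X|, and their squares sum to the
   number of colliding pairs. *)
pose c u := (\sum_(x in X) (f x == u))%N.
have cardE : #|X| = (\sum_(u in f @: X) c u)%N.
  rewrite exchange_big -sum1_card; apply: eq_bigr => x xX.
  rewrite (bigD1 (f x)) ?imset_f //= eqxx big1 // => u /andP[_].
  by rewrite eq_sym => /negPf->.
have collE : (\sum_(x in X) \sum_(y in X) (f x == f y) = \sum_(u in f @: X) c u ^ 2)%N.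
  transitivity (\sum_(u in f @: X) \sum_(x in X) (f x == u) * c u)%N; last first.
    by apply: eq_bigr => u _; rewrite -mulnn {2}/c big_distrl.
  rewrite [RHS]exchange_big; apply: eq_bigr => x xX.
  rewrite [RHS](bigD1 (f x)) ?imset_f //= eqxx mul1n [X in (_ = _ + X)%N]big1 ?addn0.
    by rewrite /c; apply: eq_bigr => y _; rewrite eq_sym.
  by move=> u /andP[_]; rewrite eq_sym => /negPf->.
rewrite collE {1}cardE -mulnn big_distrlr /=.
rewrite -(leq_pmul2l (isT : 0 < 2)%N).
have -> : (2 * (#|f @: X| * \sum_(u in f @: X) c u ^ 2) =
  \sum_(u in f @: X) \sum_(v in f @: X) (c u ^ 2 + c v ^ 2))%N.
  under [RHS]eq_bigr => u _ do rewrite big_split /= sum_nat_const.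
  by rewrite [RHS]big_split /= -big_distrr /= sum_nat_const mul2n addnn.
rewrite big_distrr leq_sum // => u _; rewrite big_distrr leq_sum // => v _.
exact: nat_Cauchy.
Qed.

(** Pigeonhole: X and g - Y are too large to be disjoint. *)
Lemma sumset_full (G : finZmodType) (X Y : {set G}) (g : G) :
  (#|G| < #|X| + #|Y|)%N -> exists x y, [/\ x \in X, y \in Y & g = x + y].
Proof.
move=> XY; pose Z := [set g - y | y in Y].
have cZ : #|Z| = #|Y| by apply: card_imset => y y' /addrI /oppr_inj.
have : (X :&: Z != set0).
  rewrite -card_gt0 -(ltn_add2l #|X :|: Z|) addn0 cardsUI cZ.
  exact: leq_ltn_trans (max_card _) XY.
case/set0Pn=> x /setIP[xX /imsetP[y yY xE]].
by exists x, y; split=> //; rewrite xE subrK.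
Qed.

Section EightProducts.
Variables (F : finFieldType) (A B : {set F}).
Hypothesis addA_neq0 : forall a a', a \in A -> a' \in A -> a + a' != 0.
Hypothesis cardAB : (2 * #|F| <= #|A| * #|B|)%N.

(** Additive energy: the number of collisions of (a, b) -> a + xi b on A x B. *)
Let energy (xi : F) : nat := (\sum_(a in A) \sum_(a' in A)
  \sum_(b in B) \sum_(b' in B) (a + xi * b == a' + xi * b')%R)%N.

(** Exchanging b and b' turns the equation for - xi into the one for xi. *)
Let energyN xi : energy (- xi) = energy xi.
Proof.
apply: eq_bigr => a _; apply: eq_bigr => a' _; rewrite exchange_big.
apply: eq_bigr => b _; apply: eq_bigr => b' _; congr nat_of_bool.
rewrite -subr_eq0 -[RHS]subr_eq0 !opprD; congr (_ == 0); ring.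
Qed.

Let dilated (xi : F) : {set F} := [set u.1 + xi * u.2 | u in setX A B].

Let dilated_energy xi : ((#|A| * #|B|) ^ 2 <= #|dilated xi| * energy xi)%N.
Proof.
have := card_sqr_le_collisions (fun u : F * F => u.1 + xi * u.2) (setX A B).
rewrite cardsX; congr (_ <= _ * _)%N.
rewrite /energy.
transitivity (\sum_(a in A) \sum_(b in B) \sum_(a' in A) \sum_(b' in B)
   (a + xi * b == a' + xi * b')%R)%N.
  rewrite [RHS]pair_big /=; apply: eq_big => [[a b]|[a b] _] /=; first by rewrite inE.
  by rewrite [RHS]pair_big /=; apply: eq_bigl => -[a' b'] /=; rewrite inE.
by apply: eq_bigr => a _; rewrite exchange_big.
Qed.

(** A quadruple with b != b' determines xi, so it counts at most once. If b = b' then a = a' is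
    forced, and the quadruple counts for every xi. *)
Let sum_energy :
  (\sum_(xi : F | xi != 0%R) energy xi <=
    #|F|.-1 * (#|A| * #|B|) + (#|A| * #|B|) ^ 2)%N.
Proof.
have cF : #|[pred xi : F | xi != 0]| = #|F|.-1.
  by rewrite -(cardC1 (0 : F)); apply: eq_card => x; rewrite !inE.
have bnd a a' b b' : (\sum_(xi : F | xi != 0%R) (a + xi * b == a' + xi * b')%R <=
    #|F|.-1 * ((a == a') && (b == b')) + 1)%N.
  case: (altP (b =P b')) => [->|bb'] /=.
    case: (altP (a =P a')) => [_|aa'] /=.
      rewrite muln1 -cF -sum1_card; apply: leq_trans (leq_addr _ _).
      by apply: leq_sum => i _; exact: leq_b1.
    by rewrite big1 // => xi _; rewrite (inj_eq (addIr _)) (negPf aa').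
  rewrite andbF muln0 add0n -big_mkcondr /=.
  rewrite sum1_card; apply/card_le1_eqP => x y; rewrite -!topredE /=.
  move=> /andP[_ /eqP hx] /andP[_ /eqP hy].
  have bb0 : b - b' != 0 by rewrite subr_eq0.
  apply: (mulIf bb0).
  have e y' : a + y' * b = a' + y' * b' -> y' * (b - b') = a' - a.
    by move=> h; rewrite mulrBr; apply/eqP; rewrite subr_eq -addrAC -h addrAC subrr add0r.
  by rewrite (e _ hx) (e _ hy).
rewrite /energy.
under eq_bigr do idtac.
rewrite exchange_big /=.
under eq_bigr => a _ do (rewrite exchange_big /=; under eq_bigr => a' _ do
  (rewrite exchange_big /=; under eq_bigr => b _ do rewrite exchange_big /=)).
apply: (@leq_trans (\sum_(a in A) \sum_(a' in A) \sum_(b in B) \sum_(b' in B)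
   (#|F|.-1 * ((a == a') && (b == b')) + 1))%N).
  do 4 (apply: leq_sum => ? _); exact: bnd.
have e1 a : a \in A -> (\sum_(a' in A) \sum_(b in B) \sum_(b' in B)
   (#|F|.-1 * ((a == a') && (b == b')) + 1) = #|F|.-1 * #|B| + #|A| * (#|B| * #|B|))%N.
  move=> aA.
  have e2 a' : (\sum_(b in B) \sum_(b' in B)
     (#|F|.-1 * ((a == a') && (b == b')) + 1) =
      (a == a') * (#|F|.-1 * #|B|) + #|B| * #|B|)%N.
    under eq_bigr => b bB.
      rewrite big_split /= sum1_card -big_distrr /= (bigD1 b) //= eqxx andbT.
      rewrite big1 => [|b' /andP[_ /negPf]]; last by rewrite eq_sym => ->; rewrite andbF.
      over.
    by rewrite sum_nat_const addn0; case: (a == a') => /=; lia.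
  under eq_bigr do rewrite e2.
  rewrite big_split /= sum_nat_const (bigD1 a) //= eqxx mul1n big1 ?addn0 //.
  by move=> a' /andP[_ /negPf]; rewrite eq_sym => ->.
rewrite (eq_bigr _ e1) sum_nat_const -mulnn mulnDr eq_leq //.
by congr (_ + _)%N; [exact: mulnCA | rewrite mulnA mulnACA].
Qed.

(* Glibichuk's argument: a dilation with small energy makes both A + xi B and
   A - xi B larger than half of F; the second meets its opposite, which writes
   xi as (a1 + a2) / (b1 + b2). *)
Lemma sum_eight_products (x : F) : (3 < #|F|)%N ->
  exists a1 a2 a3 a4 b1 b2 b3 b4,
    [/\ [/\ a1 \in A, a2 \in A, a3 \in A & a4 \in A],
        [/\ b1 \in B, b2 \in B, b3 \in B & b4 \in B] &
        x = (b1 + b2) * (a3 + a4) + (a1 + a2) * (b3 + b4)].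
Proof.
move=> F3.
(* Averaging over the q - 1 nonzero dilations. With n = |A||B|, failure for all xi gives n (q - 2)
   <= q (q - 1), which contradicts n >= 2q as soon as q > 3. *)
have [xi /andP[xi0 xiE]] :
    exists xi : F, (xi != 0) && (#|F| * energy xi < 2 * (#|A| * #|B|) ^ 2)%N.
  apply/existsP; apply: contraT => /existsPn h.
  have : (\sum_(xi : F | xi != 0%R) 2 * (#|A| * #|B|) ^ 2 <=
          \sum_(xi : F | xi != 0%R) #|F| * energy xi)%N.
    apply: leq_sum => xi xi0; have := h xi; rewrite xi0 /= -leqNgt //.
  rewrite sum_nat_const -big_distrr /=.
  have -> : #|[pred xi : F | xi != 0]| = #|F|.-1.
    by rewrite -(cardC1 (0 : F)); apply: eq_card => y; rewrite !inE.
  move: sum_energy F3 cardAB; set n := (#|A| * #|B|)%N; set q := #|F|.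
  set s := (\sum_(_ | _) _)%N => h1 h2 h3 h4.
  have h5 : (q.-1 * (2 * n ^ 2) <= q * (q.-1 * n + n ^ 2))%N.
    by apply: (leq_trans h4); rewrite leq_mul2l h1 orbT.
  have n0 : (0 < n)%N by lia.
  have h6 : (q.-1 * (2 * n) <= q * (q.-1 + n))%N.
    by rewrite -(leq_pmul2r n0); move: h5; rewrite -mulnn; nia.
  case: q h2 h3 h6 {h4 h5 h1} => // q /=; nia.
have big e : e = xi \/ e = - xi -> (#|F| < #|dilated e| + #|dilated e|)%N.
  move=> eE; have eqE : energy e = energy xi by case: eE => ->; rewrite ?energyN.
  have := dilated_energy e; rewrite eqE => h; rewrite addnn -mul2n.
  rewrite ltnNge; apply/negP => h'.
  have := leq_mul h' (leqnn (energy xi)); lia.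
have [s1 [s2 [/imsetP[[a1 b1] + ->] /imsetP[[a2 b2] + ->]]]] :=
  sumset_full (0 : F) (big (- xi) (or_intror erefl)).
rewrite !inE /= => /andP[a1A b1B] /andP[a2A b2B] h0.
have hxi : a1 + a2 = xi * (b1 + b2) 
    by apply/eqP; rewrite -subr_eq0 h0; apply/eqP; ring.
have b0 : b1 + b2 != 0.
  by apply: contraNneq (addA_neq0 a1A a2A) => b0; rewrite hxi b0 mulr0.
(* Write x / (b1 + b2) as a sum of two elements of A + xi B. On multiplying back, xi (b1 + b2)
   becomes a1 + a2 and xi disappears. *)
have [s3 [s4 [/imsetP[[a3 b3] + ->] /imsetP[[a4 b4] + ->]]]] :=
  sumset_full (x / (b1 + b2)) (big xi (or_introl erefl)).
rewrite !inE /= => /andP[a3A b3B] /andP[a4A b4B] hx.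
exists a1, a2, a3, a4, b1, b2, b3, b4; split=> //.
have -> : x = (x / (b1 + b2)) * (b1 + b2) by rewrite divfK.
rewrite hx hxi; ring.
Qed.

End EightProducts.

(** * Fibonacci and Lucas numbers modulo a prime *)

Fixpoint lucas (n : nat) : nat :=
  match n with
  | 0 => 2
  | 1 => 1
  | (m.+1 as k).+1 => (lucas k + lucas m)%N
  end.

Local Arguments fib : simpl never.
Local Arguments lucas : simpl never.

Lemma fib0 : fib 0 = 0%N. Proof. by []. Qed.
Lemma fib1 : fib 1 = 1%N. Proof. by []. Qed.
Lemma fib2 : fib 2 = 1%N. Proof. by []. Qed.
Lemma lucas0 : lucas 0 = 2. Proof. by []. Qed.
Lemma lucas1 : lucas 1 = 1%N. Proof. by []. Qed.

Definition fib_small := (fib0, fib1, fib2, lucas0, lucas1).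

Lemma fibSS n : fib n.+2 = (fib n.+1 + fib n)%N. Proof. by []. Qed.

Lemma lucasSS n : lucas n.+2 = (lucas n.+1 + lucas n)%N. Proof. by []. Qed.

Lemma nat_ind2 (P : nat -> Prop) :
  P 0 -> P 1 -> (forall n, P n -> P n.+1 -> P n.+2) -> forall n, P n.
Proof.
move=> P0 P1 PS n; suff [] : P n /\ P n.+1 by [].
by elim: n => // n [Pn PSn]; split=> //; exact: PS.
Qed.

Lemma fibD m n : fib (m + n).+1 = (fib m.+1 * fib n.+1 + fib m * fib n)%N.
Proof.
elim/nat_ind2: m => [||m IH1 IH2].
- by rewrite add0n !fib_small; lia.
- by rewrite add1n fibSS !fib_small; lia.
- by rewrite !addSn fibSS -addSn IH2 IH1 !fibSS; lia.
Qed.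

Section FibRing.
Variable R : comRingType.
Implicit Types (b j n : nat).

Lemma cassini n : (fib n.+1)%:R ^+ 2 - (fib n.+1)%:R * (fib n)%:R - (fib n)%:R ^+ 2
  = (-1) ^+ n :> R.
Proof.
elim: n => [|n IH]; first by rewrite !fib_small expr0 expr1n; ring.
by rewrite [RHS]exprS -IH fibSS natrD; ring.
Qed.

Lemma lucasE n : (lucas n)%:R = 2 * (fib n.+1)%:R - (fib n)%:R :> R.
Proof.
elim/nat_ind2: n => [||n IH1 IH2]; [by rewrite !fib_small; ring | by rewrite !fib_small; ring |].
by rewrite lucasSS natrD IH1 IH2 !fibSS !natrD; ring.
Qed.

Lemma fib_double n :
  (fib (2 * n))%:R = (fib n)%:R * (2 * (fib n.+1)%:R - (fib n)%:R) :> R.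
Proof.
case: n => [|n]; first by rewrite fib0 mul0r.
have -> : (2 * n.+1 = (n + n.+1).+1)%N by lia.
by rewrite fibD natrD !natrM fibSS natrD; ring.
Qed.

Lemma fib_doubleS n :
  (fib (2 * n).+1)%:R = (fib n.+1)%:R ^+ 2 + (fib n)%:R ^+ 2 :> R.
Proof. by rewrite mul2n -addnn fibD natrD !natrM; ring. Qed.

(** With b fixed, both sides of each identity below satisfy the Fibonacci recurrence in j, so only j
    = 0 and j = 1 have to be checked. *)
Let linear_rec_eq (f g : nat -> R) : f 0 = g 0 -> f 1 = g 1 ->
  (forall n, f n.+2 = f n.+1 + f n) -> (forall n, g n.+2 = g n.+1 + g n) ->
  forall n, f n = g n.
Proof. by move=> h0 h1 hf hg; elim/nat_ind2=> // n h h'; rewrite hf hg h h'. Qed.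

(** The product formula for F_m L_n with m = b + j and n = b, which avoids a subtraction of indices.
    The three companions that follow are used to factor sums and differences of Fibonacci or Lucas
    numbers. *)
Lemma fib_lucas b j : (fib (b + j))%:R * (lucas b)%:R
  = (fib (2 * b + j))%:R + (-1) ^+ b * (fib j)%:R :> R.
Proof.
move: j; apply: linear_rec_eq => [||n|n]; last 2 first.
- by rewrite !addnS fibSS natrD mulrDl.
- by rewrite !addnS !fibSS !natrD; ring.
- by rewrite !addn0 lucasE fib_double fib_small; ring.
- by rewrite !addn1 lucasE fib_doubleS -cassini ?fib_small; ring.
Qed.

Lemma lucas_fib b j : (lucas (b + j))%:R * (fib b)%:R
  = (fib (2 * b + j))%:R - (-1) ^+ b * (fib j)%:R :> R.
Proof.
move: j; apply: linear_rec_eq => [||n|n]; last 2 first.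
- by rewrite !addnS lucasSS natrD mulrDl.
- by rewrite !addnS !fibSS !natrD; ring.
- by rewrite !addn0 lucasE fib_double fib_small; ring.
- by rewrite !addn1 lucasE fib_doubleS -cassini fibSS natrD ?fib_small; ring.
Qed.

Lemma lucas_sub b j : 5 * (fib (b + j))%:R * (fib b)%:R
  = (lucas (2 * b + j))%:R - (-1) ^+ b * (lucas j)%:R :> R.
Proof.
move: j; apply: linear_rec_eq => [||n|n]; last 2 first.
- by rewrite !addnS fibSS natrD; ring.
- by rewrite !addnS !lucasSS !natrD; ring.
- by rewrite !addn0 lucasE fib_double fib_doubleS -cassini ?fib_small; ring.
- by rewrite !addn1 lucasE fibSS natrD fib_double fib_doubleS -cassini ?fib_small; ring.
Qed.

Lemma lucas_mul b j : (lucas (b + j))%:R * (lucas b)%:R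
  = (lucas (2 * b + j))%:R + (-1) ^+ b * (lucas j)%:R :> R.
Proof.
move: j; apply: linear_rec_eq => [||n|n]; last 2 first.
- by rewrite !addnS lucasSS natrD; ring.
- by rewrite !addnS !lucasSS !natrD; ring.
- by rewrite !addn0 !lucasE fib_double fib_doubleS -cassini ?fib_small; ring.
- by rewrite !addn1 !lucasE !fibSS !natrD fib_double fib_doubleS -cassini ?fib_small; ring.
Qed.

End FibRing.

(** The Fibonacci indices fill the even part of [2I, 4I) and the Lucas indices that of [0, 2I).
    Hence m - n is always positive, m + n stays below 6I, and the sign (-1)^n is 1. *)
Definition fib_residues (F : finFieldType) (I : nat) : {set F} :=
  [set (fib (2 * (I + i)))%:R | i : 'I_I].
Definition lucas_residues (F : finFieldType) (I : nat) : {set F} :=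
  [set (lucas (2 * i))%:R | i : 'I_I].

Lemma fib_lucas_residues (F : finFieldType) (I : nat) (a b : F) :
  a \in fib_residues F I -> b \in lucas_residues F I ->
  exists n n', [/\ (0 < n <= 6 * I)%N, (0 < n' <= 6 * I)%N &
    a * b = (fib n)%:R + (fib n')%:R].
Proof.
move=> /imsetP[i _ ->] /imsetP[j _ ->].
have := ltn_ord i; have := ltn_ord j => hj hi.
exists (2 * (2 * j) + 2 * (I + i - j))%N, (2 * (I + i - j))%N; split; try lia.
have {1}-> : (2 * (I + i) = 2 * j + 2 * (I + i - j))%N by lia.
by rewrite fib_lucas -signr_odd oddM mul1r.
Qed.

Section Residues.
Variables (F : finFieldType) (I : nat).
Hypothesis fib_neq0 : forall k, (0 < k <= 8 * I)%N -> (fib k)%:R != 0 :> F.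
Hypothesis two_neq0 : 2 != 0 :> F.
Hypothesis five_neq0 : 5 != 0 :> F.

(** For k > 0, L_k divides F_(2k): this is why the hypothesis on [fib] goes up to 8I. *)
Let lucas_neq0 k : (k <= 4 * I)%N -> (lucas k)%:R != 0 :> F.
Proof.
case: k => [//|k] hk.
have := @fib_neq0 (2 * k.+1); rewrite fib_double -lucasE mulf_eq0 => h.
by have /norP[] := h ltac:(lia).
Qed.

Let sign_cases (b : nat) : (-1) ^+ b = 1 :> F \/ (-1) ^+ b = -1 :> F.
Proof. by rewrite -signr_odd; case: odd; [right|left]; rewrite ?expr1 ?expr0. Qed.

(** The sum and the difference are F_(b+j) L_b and L_(b+j) F_b, in an order that depends on the
    parity of b. *)
Let fib_pm b j : (0 < b)%N -> (b + j <= 4 * I)%N ->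
  (fib (2 * b + j))%:R != (fib j)%:R :> F /\ (fib (2 * b + j))%:R + (fib j)%:R != 0 :> F.
Proof.
move=> b0 bj.
have h1 : (fib (2 * b + j))%:R + (-1) ^+ b * (fib j)%:R != 0 :> F.
  by rewrite -fib_lucas mulf_neq0 ?lucas_neq0 ?fib_neq0 //; lia.
have h2 : (fib (2 * b + j))%:R - (-1) ^+ b * (fib j)%:R != 0 :> F.
  by rewrite -lucas_fib mulf_neq0 ?lucas_neq0 ?fib_neq0 //; lia.
rewrite -subr_eq0; case: (sign_cases b) h1 h2 => ->.
  by rewrite mul1r.
by rewrite mulN1r opprK.
Qed.

(** The difference is L_(b+j) L_b for odd b and 5 F_(b+j) F_b for even b; hence the exclusion of
    characteristic 5. *)
Let lucas_pm b j : (0 < b)%N -> (b + j <= 4 * I)%N ->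
  (lucas (2 * b + j))%:R != (lucas j)%:R :> F.
Proof.
move=> b0 bj.
have h1 : (lucas (2 * b + j))%:R + (-1) ^+ b * (lucas j)%:R != 0 :> F.
  by rewrite -lucas_mul mulf_neq0 ?lucas_neq0 //; lia.
have h2 : (lucas (2 * b + j))%:R - (-1) ^+ b * (lucas j)%:R != 0 :> F.
  by rewrite -lucas_sub !mulf_neq0 ?fib_neq0 //; lia.
rewrite -subr_eq0; case: (sign_cases b) h1 h2 => ->.
  by rewrite mul1r.
by rewrite mulN1r opprK.
Qed.

Lemma card_fib_residues : #|fib_residues F I| = I.
Proof.
rewrite card_imset ?card_ord //.
suff ineq (i i' : 'I_I) : (i < i')%N -> (fib (2 * (I + i)))%:R != (fib (2 * (I + i')))%:R :> F.
  move=> i i' /eqP; apply: contraTeq; rewrite neq_ltn => /orP[/ineq|/ineq] //.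
  by rewrite eq_sym.
move=> ii'; have -> : (2 * (I + i') = 2 * (i' - i) + 2 * (I + i))%N by lia.
by rewrite eq_sym; apply: (fib_pm _ _).1; have := ltn_ord i'; lia.
Qed.

Lemma card_lucas_residues : #|lucas_residues F I| = I.
Proof.
rewrite card_imset ?card_ord //.
suff ineq (i i' : 'I_I) : (i < i')%N -> (lucas (2 * i))%:R != (lucas (2 * i'))%:R :> F.
  move=> i i' /eqP; apply: contraTeq; rewrite neq_ltn => /orP[/ineq|/ineq] //.
  by rewrite eq_sym.
move=> ii'; have -> : (2 * i' = 2 * (i' - i) + 2 * i)%N by lia.
by rewrite eq_sym; apply: lucas_pm; have := ltn_ord i'; lia.
Qed.

Lemma fib_residues_add_neq0 a a' :
  a \in fib_residues F I -> a' \in fib_residues F I -> a + a' != 0.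
Proof.
move=> /imsetP[i _ ->] /imsetP[i' _ ->].
wlog ii' : i i' / (i <= i')%N.
  by move=> h; case: (leqP i i') => [/h|/ltnW/h] //; rewrite addrC.
have [eqi|lti] := eqVneq (i : nat) i'.
  have dbl (x : F) : x + x = 2 * x by ring.
  by rewrite eqi dbl mulf_neq0 // fib_neq0 //; have := ltn_ord i'; lia.
have -> : (2 * (I + i') = 2 * (i' - i) + 2 * (I + i))%N by lia.
by rewrite addrC; apply: (fib_pm _ _).2; have := ltn_ord i'; lia.
Qed.

End Residues.

Lemma coprime_fibS n : coprime (fib n) (fib n.+1).
Proof.
elim: n => [|n IH]; first by rewrite !fib_small coprimen1.
by rewrite fibSS /coprime gcdnDl gcdnC.
Qed.

Lemma dvdn_fib_sub p m n : prime p ->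
  (p %| fib n -> p %| fib (n + m) -> p %| fib m)%N.
Proof.
case: n => [|n] pp; first by rewrite add0n.
move=> pn; rewrite addSn fibD dvdn_addr ?(dvdn_mulr _ pn) // Euclid_dvdM // => /orP[h|//].
have : (p %| gcdn (fib n) (fib n.+1))%N by rewrite dvdn_gcd h pn.
by rewrite (eqP (coprime_fibS n)) dvdn1 => /eqP p1; rewrite p1 in pp.
Qed.

(** Euclid's algorithm by subtraction on the indices, by induction on m + n. *)
Lemma dvdn_fib_gcd p m n : prime p ->
  (p %| fib m -> p %| fib n -> p %| fib (gcdn m n))%N.
Proof.
move=> pp; have [s] := ubnP (m + n); elim: s m n => // s IH m n hs pm pn.
wlog mn : m n hs pm pn / (m <= n)%N.
  by move=> h; case: (leqP m n) => [/h|/ltnW/h] h'; [|rewrite gcdnC]; apply: h'; rewrite // addnC.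
case: m => [|m] in hs pm mn *; first by rewrite gcd0n.
rewrite -(subnKC mn) gcdnDl; apply: IH => //; first by lia.
by apply: (dvdn_fib_sub pp pm); rewrite subnKC.
Qed.

Lemma exprS_golden (S : ringType) (x : S) n : x ^+ 2 = x + 1 ->
  x ^+ n.+1 = (fib n.+1)%:R * x + (fib n)%:R.
Proof.
move=> x2; elim: n => [|n IH]; first by rewrite !fib_small expr1 mul1r addr0.
rewrite exprSr IH mulrDl -mulrA -expr2 x2 fibSS natrD mulrDr mulr1 mulrDl.
by rewrite addrAC.
Qed.

Lemma natr_Fp_eq0 p n : prime p -> (n%:R == 0 :> 'F_p) = (p %| n)%N.
Proof. by move=> pp; rewrite (dvdn_pcharf (pchar_Fp pp)). Qed.

(* Frobenius applied to 2x - 1, a square root of 5, in the matrix ring where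
   x = [[1,1],[1,0]] is a root of x^2 = x + 1. *)
Lemma sqr_fib_prime p : prime p -> (2 < p)%N -> (p != 5)%N ->
  (fib p)%:R ^+ 2 = 1 :> 'F_p.
Proof.
move=> pp p2 p5.
pose x : 'M['F_p]_2 := \matrix_(i < 2, j < 2) (i + j < 2)%:R.
have x2 : x ^+ 2 = x + 1.
  apply/matrixP => i j; rewrite expr2 -mulmxE !mxE !big_ord_recl big_ord0 !mxE.
  by case: i j => [[|[|[]]] //= ?] [[|[|[]]] //= ?];
    rewrite /= ?(mulr0,mulr1,addr0,add0r,mul0r,mul1r).
have chM : p \in [pchar 'M['F_p]_2] by rewrite pchar_lalg pchar_Fp.
pose y := x *+ 2 - 1.
have y2 : y ^+ 2 = 5%:R.
  rewrite /y sqrrB1 exprMn_n x2 mulrnDl -mulrnA [X in X + 1]addrAC subrr add0r.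
  by rewrite -mulrSr.
have podd : odd p by case: (even_prime pp) => [p_2|//]; rewrite p_2 in p2.
have yp : y ^+ p = y *+ (5 ^ p./2).
  have yn n : y ^+ (2 * n).+1 = y *+ (5 ^ n) by rewrite exprS exprM y2 -natrX mulr_natr.
  have ph : (2 * p./2).+1 = p by rewrite mul2n -[RHS]odd_double_half podd.
  by have := yn p./2; rewrite ph.
have := pFrobenius_autB_comm chM (commr1 (x *+ 2)).
have := exprS_golden p.-1 x2; rewrite (prednK (prime_gt0 pp)) => xp.
rewrite pFrobenius_autMn pFrobenius_aut1 !pFrobenius_autE -/y yp xp.
(* Off the diagonal the identity matrix vanishes: y has entry 2 and x^p has entry F_p, so 2 *
   5^((p-1)/2) = 2 F_p. Fermat's theorem then gives F_p^2 = 5^(p-1) = 1. *)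
move=> /matrixP/(_ 0 1).
rewrite !mulr_natl /y !(mulmxnE, mxE) /= !mul0rn ?oppr0 !addr0.
rewrite -!mulrnA [(fib p * 2)%N]mulnC !mul1n => fib2E.
have fibE : (5 ^ p./2)%:R = (fib p)%:R :> 'F_p.
  have two0 : 2%:R != 0 :> 'F_p by rewrite natr_Fp_eq0 // gtnNdvd.
  apply: (mulfI two0).
  by have : (2 * 5 ^ p./2)%:R = (2 * fib p)%:R :> 'F_p := fib2E; rewrite !natrM.
rewrite -fibE -natrX -expnM natrX.
have -> : (p./2 * 2 = p.-1)%N.
  by rewrite -{2}(odd_double_half p) podd muln2.
have five0 : 5%:R != 0 :> 'F_p.
  by rewrite natr_Fp_eq0 // dvdn_prime2 //; rewrite eq_sym in p5.
apply: (mulfI five0); rewrite mulr1 -exprS (prednK (prime_gt0 pp)).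
by have := expf_card (5%:R : 'F_p); rewrite card_Fp.
Qed.

(** Cassini's identity at the odd index p, with F_p^2 = 1, becomes F_(p+1) (F_(p+1) - F_p) = 0, that
    is F_(p+1) F_(p-1) = 0 modulo p. *)
Lemma dvdn_fib_prime p : prime p -> (2 < p)%N -> (p != 5)%N ->
  (p %| fib p.-1)%N \/ (p %| fib p.+1)%N.
Proof.
move=> pp p2 p5; apply/orP.
rewrite -Euclid_dvdM // -natr_Fp_eq0 // natrM; apply/eqP.
have podd : odd p by case: (even_prime pp) => [p_2|//]; rewrite p_2 in p2.
have := cassini 'F_p p; rewrite sqr_fib_prime // -signr_odd podd /= expr1.
have -> : fib p.+1 = (fib p + fib p.-1)%N.
  by rewrite -{1}(prednK (prime_gt0 pp)) fibSS (prednK (prime_gt0 pp)).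
move/(congr1 (fun t => t + 1)); rewrite addNr subrK natrD => <-; ring.
Qed.

(** Indices n with p | F_n are stable under gcd, so k may be replaced by its gcd with p - 1 or p +
    1. *)
Lemma dvdn_fib_rank p k : prime p -> (2 < p)%N -> (p != 5)%N -> (0 < k)%N ->
  (p %| fib k)%N ->
  exists2 d, (0 < d <= k)%N &
    (p %| fib d)%N /\ ((d %| p.-1)%N \/ (d %| p.+1)%N).
Proof.
move=> pp p2 p5 k0 pk; have [pf|pf] := dvdn_fib_prime pp p2 p5.
  exists (gcdn k p.-1); first by rewrite gcdn_gt0 k0 (dvdn_leq k0) ?dvdn_gcdl.
  by split; [exact: dvdn_fib_gcd | left; exact: dvdn_gcdr].
exists (gcdn k p.+1); first by rewrite gcdn_gt0 k0 (dvdn_leq k0) ?dvdn_gcdl.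
by split; [exact: dvdn_fib_gcd | right; exact: dvdn_gcdr].
Qed.

(** Expanding (b1 + b2)(a3 + a4) + (a1 + a2)(b3 + b4) gives eight products, each a sum of two
    Fibonacci numbers of index at most 6I: sixteen in all. The condition on I * I is the size
    condition on A and B. *)
Lemma good16_fib_rank (R : realType) (p I : nat) (B : R) : prime p -> (5 < p)%N ->
  (2 * p <= I * I)%N -> (forall k, (0 < k <= 8 * I)%N -> ~~ (p %| fib k)%N) ->
  (6 * I)%:R <= B -> good16 p B.
Proof.
move=> pp p5 pI rk IB lam.
pose F := 'F_p : finFieldType.
have fib0' k : (0 < k <= 8 * I)%N -> (fib k)%:R != 0 :> F.
  by move=> /rk; rewrite natr_Fp_eq0.
have two0 : 2 != 0 :> F by rewrite natr_Fp_eq0 // gtnNdvd //; lia.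
have five0 : 5 != 0 :> F by rewrite natr_Fp_eq0 // gtnNdvd //; lia.
have cF : #|F| = p by rewrite card_Fp.
have cAB : (2 * #|F| <= #|fib_residues F I| * #|lucas_residues F I|)%N.
  by rewrite card_fib_residues ?card_lucas_residues // cF.
pose l := `|(lam %% p)%Z|%N.
have p0 : p%:Z != 0 by have := prime_gt0 pp; lia.
have lE : (lam %% p)%Z = l%:Z by rewrite /l gez0_abs // modz_ge0.
have F3 : (3 < #|F|)%N by rewrite cF; lia.
have [a1 [a2 [a3 [a4 [b1 [b2 [b3 [b4 [[ha1 ha2 ha3 ha4] [hb1 hb2 hb3 hb4] lS]]]]]]]]] :=
  sum_eight_products (@fib_residues_add_neq0 F I fib0' two0 five0) cAB l%:R F3.
have prod a b := @fib_lucas_residues F I a b.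
have [n1 [m1 [hn1 hm1 e1]]] := prod _ _ ha3 hb1.
have [n2 [m2 [hn2 hm2 e2]]] := prod _ _ ha3 hb2.
have [n3 [m3 [hn3 hm3 e3]]] := prod _ _ ha4 hb1.
have [n4 [m4 [hn4 hm4 e4]]] := prod _ _ ha4 hb2.
have [n5 [m5 [hn5 hm5 e5]]] := prod _ _ ha1 hb3.
have [n6 [m6 [hn6 hm6 e6]]] := prod _ _ ha1 hb4.
have [n7 [m7 [hn7 hm7 e7]]] := prod _ _ ha2 hb3.
have [n8 [m8 [hn8 hm8 e8]]] := prod _ _ ha2 hb4.
pose s := [:: n1; m1; n2; m2; n3; m3; n4; m4; n5; m5; n6; m6; n7; m7; n8; m8].
exists (fun i : 'I_16 => nth 0%N s i); split.
  move=> i; have : all (fun n => 0 < n <= 6 * I)%N s.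
    by rewrite /= hn1 hm1 hn2 hm2 hn3 hm3 hn4 hm4 hn5 hm5 hn6 hm6 hn7 hm7 hn8 hm8.
  move/all_nthP=> /(_ 0%N i (ltn_ord i)) /andP[h1 h2]; split=> //.
  by apply: le_trans IB; rewrite ler_nat.
have sE : \sum_(i < 16) (fib (nth 0%N s i))%:Z = (\sum_(x <- s) fib x)%N%:Z.
  by rewrite (big_morph Posz PoszD erefl) (big_nth 0%N) big_mkord.
rewrite sE -[RHS]modz_mod lE !modz_nat; congr Posz.
rewrite -!val_Fp_nat //; congr (nat_of_ord _).
rewrite natr_sum lS !big_cons big_nil addr0 !addrA.
rewrite !mulrDl !mulrDr.
transitivity (a3 * b1 + a3 * b2 + a4 * b1 + a4 * b2 + a1 * b3 + a1 * b4 + a2 * b3 + a2 * b4).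
  by rewrite e1 e2 e3 e4 e5 e6 e7 e8 !addrA.
ring.
Qed.

(** * Selberg's sieve *)

Lemma prod1D_subset (R : comRingType) (I : finType) (f : I -> R) (T : {set I}) :
  \prod_(i in T) (1 + f i) = \sum_(J : {set I} | J \subset T) \prod_(i in J) f i.
Proof.
rewrite big_mkcond /=.
transitivity (\prod_i ((if i \in T then f i else 0) + 1)).
  by apply: eq_bigr => i _; case: ifP; rewrite ?add0r // addrC.
rewrite bigA_distr [RHS]big_mkcond; apply: eq_bigr => J _.
rewrite -big_mkcond /=; case: ifP => [/subsetP JT|/subsetPn[i iJ iT]].
  by apply: eq_bigr => i /JT->.
by rewrite (bigD1 i) //= (negPf iT) mul0r.
Qed.

(** Möbius inversion on the lattice of subsets: any i in exactly one of J and U contributes a zero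
    factor to the product. *)
Lemma sum_sign_interval (R : comRingType) (I : finType) (J U : {set I}) :
  \sum_(T : {set I} | (J \subset T) && (T \subset U)) (-1) ^+ #|T| =
  (if J == U then (-1) ^+ #|J| else 0) :> R.
Proof.
have h : \prod_i ((if i \in U then -1 else 0 : R) + (if i \in J then 0 else 1)) =
    \sum_(T in {set I}) \prod_i (if i \in T then (if i \in U then -1 else 0)
                       else if i \in J then 0 else 1) by rewrite bigA_distr.
transitivity (\sum_(T in {set I}) \prod_i (if i \in T then
     (if i \in U then -1 else 0 : R) else if i \in J then 0 else 1)).
  rewrite big_mkcond; apply: eq_bigr => T _.
  case: ifP => [/andP[/subsetP JT /subsetP TU]|/nandP[/subsetPn[i iJ iT]|/subsetPn[i iT iU]]].
  - rewrite -prodr_const big_mkcond; apply: eq_bigr => i _.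
    by case: ifP => [/TU->//|/negbT iT]; case: ifP => // /JT; rewrite (negPf iT).
  - by rewrite (bigD1 i) //= (negPf iT) iJ mul0r.
  - by rewrite (bigD1 i) //= iT (negPf iU) mul0r.
rewrite -h; case: eqP => [<-|/eqP neqJU].
  rewrite -prodr_const [RHS]big_mkcond; apply: eq_bigr => i _.
  by case: (i \in J); rewrite ?addr0 ?add0r.
have [i iJU] : exists i, (i \in J) != (i \in U).
  apply/existsP; apply: contraNT neqJU => /existsPn ne.
  by apply/eqP/setP => i; apply/eqP; move: (ne i); rewrite negbK.
rewrite (bigD1 i) //=; case: (i \in J) (i \in U) iJU => [] [] //= _.
  by rewrite addr0 mul0r.
by rewrite addNr mul0r.
Qed.

Section Selberg.
Variables (R : realFieldType) (I J : finType) (P : {set I}) (w : I -> nat) (z : nat).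
Variables (X : {set J}) (D : J -> {set I}) (x : R).
Hypothesis w_gt0 : forall i, (0 < w i)%N.
Hypothesis z_gt0 : (0 < z)%N.

(** A squarefree integer is encoded by the set T of its prime factors: [weight T] is the integer,
    union is the lcm and intersection the gcd. *)
Definition weight (T : {set I}) : nat := (\prod_(i in T) w i)%N.
Definition sieve_family : {set {set I}} :=
  [set T : {set I} | (T \subset P) && (weight T <= z)%N].
Definition sieve_mass : R := \sum_(T in sieve_family) (weight T)%:R^-1.

Hypothesis count_dvd : forall T : {set I}, T \subset P ->
  `| #|[set j in X | T \subset D j]|%:R - x / (weight T)%:R | <= 1.

Local Notation W T := ((weight T)%:R : R).
Local Notation FF := sieve_family.
Local Notation G := sieve_mass.

Let weight_gt0 T : (0 < weight T)%N.
Proof. by rewrite /weight prodn_cond_gt0. Qed.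

Let W_gt0 T : 0 < W T. Proof. by rewrite ltr0n weight_gt0. Qed.
Let W_neq0 T : W T != 0. Proof. by rewrite gt_eqF. Qed.

Let weight_subset (T U : {set I}) : T \subset U -> (weight T <= weight U)%N.
Proof.
move=> TU; rewrite /weight [leqRHS](big_setID T) /= (setIidPr TU) leq_pmulr //.
by rewrite prodn_cond_gt0.
Qed.

Let family0 : set0 \in FF.
Proof. by rewrite inE sub0set /weight big_set0. Qed.

Let family_subset (T U : {set I}) : T \subset U -> U \in FF -> T \in FF.
Proof.
move=> TU; rewrite !inE => /andP[UP Uz]; rewrite (subset_trans TU) //=.
exact: leq_trans (weight_subset TU) Uz.
Qed.

Let mass_gt0 : 0 < G.
Proof.
rewrite /sieve_mass (bigD1 set0) //= ltr_pwDl ?invr_gt0 //.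
by apply: sumr_ge0 => T _; rewrite invr_ge0 ltW.
Qed.

(* The extremal choice for Selberg's quadratic form uses 1/phi; replacing it by
   1/W costs only a bounded factor and makes the weights elementary. *)
Let lam (T : {set I}) : R :=
  (-1) ^+ #|T| * W T / G * \sum_(U in FF | T \subset U) (W U)^-1.

Let lam0 : lam set0 = 1.
Proof.
rewrite /lam cards0 expr0 mul1r.
have -> : W set0 = 1 by rewrite /weight big_set0.
have -> : \sum_(U in FF | set0 \subset U) (W U)^-1 = G.
  by apply: eq_bigl => U; rewrite sub0set andbT.
by rewrite mul1r mulVf // gt_eqF.
Qed.

Let lam_le T : T \in FF -> `|lam T| <= z%:R.
Proof.
rewrite inE => /andP[_ Tz].
rewrite /lam !normrM normrX normrN1 expr1n mul1r normfV.
rewrite (gtr0_norm mass_gt0) (gtr0_norm (W_gt0 T)) -mulrA.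
apply: (@le_trans _ _ (W T)); last by rewrite ler_nat.
rewrite ler_piMr ?(ltW (W_gt0 _)) // mulrC ler_pdivrMr // mul1r.
rewrite ger0_norm; last by apply: sumr_ge0 => U _; rewrite invr_ge0 ltW.
rewrite /sieve_mass big_mkcondr /=; apply: ler_sum => U _.
by case: ifP => // _; rewrite invr_ge0 ltW.
Qed.

(** Euler's function of the squarefree integer coded by K. *)
Let V (K : {set I}) : R := \prod_(i in K) ((w i)%:R - 1).

Let V_le K : V K <= W K.
Proof.
rewrite /V /weight natr_prod; apply: ler_prod => i _.
by rewrite gerBl ler01 andbT subr_ge0 ler1n.
Qed.

(** 1 / lcm = gcd / product, and the gcd is the sum of Euler's function over its divisors. This
    diagonalises the quadratic form, with [y] as new variables. *)
Let W_setI (T U : {set I}) : (W (T :|: U))^-1 =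
  \sum_(K : {set I} | (K \subset T) && (K \subset U)) V K / (W T * W U).
Proof.
have WIE : W (T :&: U) = \sum_(K : {set I} | K \subset T :&: U) V K.
  rewrite -prod1D_subset /weight natr_prod; apply: eq_bigr => i _.
  by rewrite addrC subrK.
have WUI : W (T :|: U) * W (T :&: U) = W T * W U.
  rewrite -!natrM /weight; congr (_%:R).
  rewrite [X in (X * _)%N = _](big_setID T) /= [X in (_ = _ * X)%N](big_setID T) /=.
  rewrite setIUl setIid (setUidPl (subsetIr U T)).
  rewrite setDUl setDv set0U (setIC U T); lia.
rewrite -mulr_suml; under eq_bigl do rewrite -subsetI.
rewrite -WIE -WUI invfM mulrCA divff ?mulr1 //.
Qed.

Let y (K : {set I}) : R := \sum_(T in FF | K \subset T) lam T / W T.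

Let yE K : y K = if K \in FF then (-1) ^+ #|K| / W K / G else 0.
Proof.
rewrite /y.
transitivity (\sum_(U in FF) (W U)^-1 / G *
    \sum_(T : {set I} | (K \subset T) && (T \subset U)) (-1) ^+ #|T|).
  under [RHS]eq_bigr do rewrite mulr_sumr.
  rewrite (exchange_big_dep (fun T => (T \in FF) && (K \subset T))) /=; last first.
    by move=> U T UF /andP[-> TU]; rewrite (family_subset TU UF).
  apply: eq_bigr => T /andP[TF KT].
  rewrite /lam mulrAC [_ * W T / G]mulrAC mulfK // mulr_sumr.
  apply: eq_big => [U|U _]; first by rewrite KT.
  by rewrite mulrC mulrA mulrAC.
under eq_bigr do rewrite sum_sign_interval.
case: ifP => KF.
  rewrite (bigD1 K) //= eqxx big1 ?addr0 => [|U /andP[_ /negPf]].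
    by rewrite mulrC mulrA.
  by rewrite eq_sym => ->; rewrite mulr0.
apply: big1 => U UF; case: eqP => [KU|]; last by rewrite mulr0.
by move: KF; rewrite KU UF.
Qed.

Let form_le : \sum_(T in FF) \sum_(U in FF) lam T * lam U / W (T :|: U) <= G^-1.
Proof.
have -> : \sum_(T in FF) \sum_(U in FF) lam T * lam U / W (T :|: U) =
    \sum_K V K * y K ^+ 2.
  transitivity (\sum_(T in FF) \sum_(U in FF) \sum_(K : {set I})
     ((K \subset T) && (K \subset U))%:R * (V K * (lam T / W T) * (lam U / W U))).
    apply: eq_bigr => T _; apply: eq_bigr => U _.
    rewrite W_setI mulr_sumr big_mkcond /=; apply: eq_bigr => K _.
    case: ifP => _; rewrite ?mul0r // mul1r invfM; ring.
  under eq_bigr do rewrite exchange_big.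
  rewrite exchange_big; apply: eq_bigr => K _.
  rewrite /y expr2 mulr_suml mulr_sumr [RHS]big_mkcondr /=; apply: eq_bigr => T _.
  case: (K \subset T) => /=; last by rewrite big1 // => U _; rewrite mul0r.
  rewrite !mulr_sumr [RHS]big_mkcondr /=; apply: eq_bigr => U _.
  by case: (K \subset U); rewrite ?mul1r ?mul0r ?mulrA //.
(* On the family, V K * y K ^+ 2 is V / (W^2 G^2), at most 1 / (W G^2) because V <= W; summing 1 / W
   yields G. *)
apply: (@le_trans _ _ (\sum_(K in FF) (W K)^-1 / G / G)).
  rewrite [leRHS]big_mkcond; apply: ler_sum => K _; rewrite yE.
  case: ifP => _; last by rewrite expr0n mulr0.
  have -> : ((-1) ^+ #|K| / W K / G) ^+ 2 = (W K)^-1 * ((W K)^-1 / G / G).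
    rewrite !exprMn -exprM muln2 -signr_odd odd_double expr0 !expr2 !mul1r; ring.
  set b := _ / G / G; rewrite [leLHS]mulrA ler_piMl //; first by rewrite /b !mulr_ge0 ?invr_ge0 // ltW.
  by rewrite ler_pdivrMr // mul1r.
by rewrite -!mulr_suml -/sieve_mass divff ?mul1r // gt_eqF.
Qed.

(** The square of the sum of [lam] over T contained in D j majorises the indicator of the sifted
    set, because [lam set0] is 1. Each pair (T, U) has error at most z^2; this crude bound suffices
    as z will be a tiny power of N. *)
Lemma selberg_sieve : 0 <= x ->
  #|[set j in X | [disjoint D j & P]]|%:R <= x / G + (#|FF| * z)%:R ^+ 2.
Proof.
move=> x0.
pose S (j : J) : R := \sum_(T in FF | T \subset D j) lam T.
apply: (@le_trans _ _ (\sum_(j in X) S j ^+ 2)).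
  rewrite -sum1_card natr_sum.
  under eq_bigl do rewrite inE.
  rewrite big_mkcondr /=; apply: ler_sum => j jX.
  case: ifP => [djP|_]; last exact: sqr_ge0.
  suff -> : S j = 1 by rewrite expr1n.
  rewrite /S (bigD1 set0) /= ?family0 ?sub0set // lam0 big1 ?addr0 //.
  move=> T /andP[/andP[TF TD] /negP[]].
  rewrite -subset0 -(setIidPl TD); move: TF; rewrite inE => /andP[TP _].
  apply: (subset_trans (setSI _ TP)); rewrite setIC.
  by move: djP; rewrite -setI_eq0 => /eqP->.
have -> : \sum_(j in X) S j ^+ 2 = \sum_(T in FF) \sum_(U in FF)
    lam T * lam U * #|[set j in X | T :|: U \subset D j]|%:R.
  transitivity (\sum_(j in X) \sum_(T in FF) \sum_(U in FF)
     lam T * lam U * (T :|: U \subset D j)%:R).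
    apply: eq_bigr => j _; rewrite expr2 {1}/S mulr_suml big_mkcondr /=.
    apply: eq_bigr => T _; rewrite /S.
    case: ifP => TD; last first.
      by rewrite big1 // => U _; rewrite subUset TD mulr0.
    rewrite mulr_sumr big_mkcondr /=; apply: eq_bigr => U _.
    by rewrite subUset TD /=; case: ifP; rewrite ?mulr1 ?mulr0.
  rewrite exchange_big; apply: eq_bigr => T _.
  rewrite exchange_big; apply: eq_bigr => U _.
  rewrite -mulr_sumr -sum1_card natr_sum; congr (_ * _).
  rewrite [RHS](eq_bigl (fun j => (j \in X) && (T :|: U \subset D j))) => [|j]; last by rewrite inE.
  by rewrite [RHS]big_mkcondr; apply: eq_bigr => j _; case: ifP.
apply: (@le_trans _ _ (\sum_(T in FF) \sum_(U in FF)
   (lam T * lam U / W (T :|: U) * x + z%:R * z%:R))).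
  apply: ler_sum => T TF; apply: ler_sum => U UF.
  have TUP : T :|: U \subset P.
    by move: TF UF; rewrite !inE subUset => /andP[-> _] /andP[-> _].
  have := count_dvd TUP; set c := #|_|%:R => hc.
  have -> : lam T * lam U * c = lam T * lam U / W (T :|: U) * x
      + lam T * lam U * (c - x / W (T :|: U)) by ring.
  rewrite lerD2l; apply: le_trans (ler_norm _) _.
  rewrite normrM -[leRHS]mulr1; apply: ler_pM => //.
  by rewrite normrM; apply: ler_pM; rewrite ?normr_ge0 // lam_le.
under eq_bigr do rewrite big_split /= -mulr_suml.
rewrite big_split /= -mulr_suml; apply: lerD.
  by rewrite mulrC ler_wpM2l.
rewrite !sumr_const -[leLHS]mulr_natr -[X in X * _]mulr_natr natrM.
rewrite [leRHS](_ : _ = z%:R * z%:R * #|FF|%:R * #|FF|%:R) //; ring.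
Qed.

End Selberg.

(** * Primes in residue classes: a Brun-Titchmarsh bound *)

Lemma card_modn_class q r N : (0 < q)%N ->
  (q * #|[set n : 'I_N.+1 | (0 < n) && (n == r %[mod q])]| <= N + q)%N /\
  (N <= q * #|[set n : 'I_N.+1 | (0 < n) && (n == r %[mod q])]| + q)%N.
Proof.
move=> q0.
(* The representative of r in 1..q rather than 0..q-1, since n = 0 is not counted. *)
pose r' := if (r %% q == 0)%N then q else (r %% q)%N.
have r'q : (r' <= q)%N by rewrite /r'; case: ifP => // _; rewrite ltnW ?ltn_pmod.
have r'0 : (0 < r')%N by rewrite /r'; case: ifP => //; rewrite lt0n => ->.
have r'E : (r' = r %[mod q])%N.
  by rewrite /r'; case: ifP => [/eqP->|_]; rewrite ?modnn ?modn_mod.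
have -> : #|[set n : 'I_N.+1 | (0 < n)%N && (n == r %[mod q])]| = ((N + (q - r')) %/ q)%N.
  rewrite -sum1_card big_mkcond /=.
  under eq_bigr do rewrite inE -[if _ then _ else _]/(nat_of_bool _).
  rewrite -(big_mkord xpredT (fun n => nat_of_bool ((0 < n)%N && (n == r %[mod q])))).
  elim: N => [|N IH].
    by rewrite big_nat1 ltnn add0n divn_small // ltn_subrL r'0 q0.
  rewrite big_nat_recr //= IH addSn divnS // addnC; congr (nat_of_bool _ + _)%N.
  by rewrite -r'E -(eqn_modDr (q - r')) subnKC // modnn.
set c := (_ %/ q)%N.
have := divn_eq (N + (q - r')) q; rewrite -/c => e.
have := ltn_pmod (N + (q - r')) q0; split; lia.
Qed.

(** [u * d.-1] stands for -u modulo d. The cases used are u = 0 and u = 2, the classes of 1 and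
    -1. *)
Lemma dvdn_pred_modn d u n : (0 < d)%N -> (0 < n)%N ->
  (d %| n.-1 + u)%N = (n == 1 + u * d.-1 %[mod d])%N.
Proof.
move=> d0; case: n => // n _ /=.
rewrite -(eqn_modDr u n.+1) -addnA -mulnSr (prednK d0) addSn -add1n.
by rewrite eqn_modDl modnMl.
Qed.

Lemma count_coprime_dvd (R : realFieldType) d k u N : (0 < d)%N -> (0 < k)%N -> coprime d k ->
  `| #|[set n : 'I_N.+1 | [&& (0 < n)%N, (d %| n.-1 + u)%N & (k %| n)%N]]|%:R
     - N%:R / d%:R / k%:R | <= 1 :> R.
Proof.
move=> d0 k0 dk; set c := #|_|.
have dk0 : (0 < d * k)%N by rewrite muln_gt0 d0.
suff [h1 h2] : (d * k * c <= N + d * k /\ N <= d * k * c + d * k)%N.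
  have dkR : 0 < (d * k)%:R :> R by rewrite ltr0n.
  have -> : N%:R / d%:R / k%:R = N%:R / (d * k)%:R :> R by rewrite natrM invfM mulrA.
  rewrite -(ler_pM2l dkR) mulr1 -[X in X * `|_|](gtr0_norm dkR) -normrM mulrBr.
  rewrite mulrCA divff ?mulr1 ?gt_eqF // -natrM.
  have h1R : (d * k * c)%:R <= N%:R + (d * k)%:R :> R by rewrite -natrD ler_nat.
  have h2R : N%:R <= (d * k * c)%:R + (d * k)%:R :> R by rewrite -natrD ler_nat.
  by rewrite ler_norml; apply/andP; split; lra.
pose r := chinese d k (1 + u * d.-1) 0.
have := card_modn_class r N dk0.
suff -> : [set n : 'I_N.+1 | (0 < n)%N && (n == r %[mod d * k])] =
  [set n : 'I_N.+1 | [&& (0 < n)%N, (d %| n.-1 + u)%N & (k %| n)%N]] by [].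
apply/setP => n; rewrite !inE; case: (ltnP 0 n) => //= n0.
rewrite chinese_remainder // dvdn_pred_modn // chinese_modl // chinese_modr //.
by rewrite mod0n.
Qed.

Lemma dvdn_prod_primes (s : seq nat) n : uniq s -> all prime s ->
  (\prod_(q <- s) q %| n)%N = all (dvdn^~ n) s.
Proof.
elim: s => [|q s IH] /=; first by rewrite big_nil dvd1n.
move=> /andP[qs us] /andP[pq ps]; rewrite big_cons Gauss_dvd ?IH //.
rewrite big_seq; apply: (big_ind (fun m => coprime q m)) => [|m m' cm cm'|q' q's].
- by rewrite coprimen1.
- by rewrite coprimeMr cm.
rewrite prime_coprime // dvdn_prime2 //; last exact: (allP ps).
by apply: contraNneq qs => ->.
Qed.

(** This is sigma(d)/d, in the place of d/phi(d) in the Brun-Titchmarsh bound. As a sum over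
    divisors it can be averaged over d by exchanging summations. *)
Definition sum_inv_div (R : realFieldType) (d : nat) : R :=
  \sum_(a < d.+1 | (a %| d)%N) a%:R^-1.

Lemma sum_inv_div1 (R : realFieldType) : sum_inv_div R 1 = 1.
Proof. by rewrite /sum_inv_div big_mkcond !big_ord_recl big_ord0 /= invr1 add0r addr0. Qed.

Lemma sum_inv_sqr_le (R : realFieldType) n :
  \sum_(m < n) ((m.+1)%:R ^+ 2)^-1 <= 2 :> R.
Proof.
case: n => [|n]; first by rewrite big_ord0.
suff : \sum_(m < n.+1) ((m.+1)%:R ^+ 2)^-1 <= 2 - (n.+1)%:R^-1 :> R.
  by move/le_trans; apply; rewrite gerBl invr_ge0.
elim: n => [|n IH]; first by rewrite big_ord1 expr1n invr1; lra.
rewrite big_ord_recr /=; apply: (le_trans (lerD IH (lexx _))).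
have n0 : 0 < (n.+1)%:R :> R by rewrite ltr0n.
have -> : n.+2%:R = n.+1%:R + 1 :> R by rewrite -natr1.
set x := n.+1%:R in n0 *.
rewrite -subr_ge0.
have -> : 2 - (x + 1)^-1 - (2 - x^-1 + ((x + 1) ^+ 2)^-1) = (x * (x + 1) ^+ 2)^-1.
  by field; rewrite !gt_eqF //; lra.
by rewrite invr_ge0 mulr_ge0 ?exprn_ge0 //; lra.
Qed.

Lemma harmonic_pow2_ge (R : realFieldType) k :
  k%:R / 2 <= \sum_(n < 2 ^ k) (n.+1)%:R^-1 :> R.
Proof.
elim: k => [|k IH]; first by rewrite mul0r sumr_ge0 // => i _; rewrite invr_ge0.
have -> : (2 ^ k.+1 = 2 ^ k + 2 ^ k)%N by rewrite expnS mul2n addnn.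
rewrite big_split_ord /= -natr1 mulrDl mul1r; apply: lerD => //.
have k0 : 0 < (2 ^ k)%:R :> R by rewrite ltr0n expn_gt0.
apply: (@le_trans _ _ (\sum_(i < 2 ^ k) ((2 ^ k)%:R * 2)^-1)).
  rewrite sumr_const card_ord -[X in _ <= X]mulr_natl invfM mulrA divff ?gt_eqF //.
  by rewrite mul1r.
apply: ler_sum => i _; rewrite lef_pV2 ?posrE ?mulr_gt0 // -natrM ler_nat.
by rewrite muln2 -addnn -addnS leq_add2l ltn_ord.
Qed.

Section PrimesInProgression.
Variables (R : realFieldType) (d u N z : nat).
Hypothesis d_gt0 : (0 < d)%N.
Hypothesis z_gt0 : (0 < z)%N.

Let w (i : 'I_z) : nat := i.+1.
Let P : {set 'I_z} := [set i : 'I_z | prime i.+1 && ~~ (i.+1 %| d)%N].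
Let w_gt0 i : (0 < w i)%N. Proof. by []. Qed.

Let weight_dvd (T : {set 'I_z}) n : (forall i, i \in T -> prime (w i)) ->
  (weight w T %| n)%N = (T \subset [set i : 'I_z | (w i %| n)%N]).
Proof.
move=> Tp; rewrite /weight -big_enum -(big_map w xpredT id) /=.
rewrite dvdn_prod_primes.
- rewrite all_map; apply/allP/subsetP => h i; rewrite ?inE.
    by move=> iT; apply: h; rewrite mem_enum.
  by rewrite mem_enum => /h; rewrite inE.
- by rewrite map_inj_uniq ?enum_uniq // => i j [] /ord_inj.
- by rewrite all_map; apply/allP => i; rewrite mem_enum; exact: Tp.
Qed.

(** A square times a squarefree number, by removing the least prime q: if q is already in T, the two
    copies move into the square. *)
Let sqr_weight_decomp n : (0 < n <= z)%N -> exists (m : nat) (T : {set 'I_z}),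
  [/\ (0 < m <= z)%N, forall i, i \in T -> prime (w i) & (n = m ^ 2 * weight w T)%N].
Proof.
have [s] := ubnP n; elim: s n => // s IH n ns /andP[n0 nz].
have [->|n1] := eqVneq n 1%N.
  by exists 1%N, set0; split=> [//|i|]; rewrite ?inE // /weight big_set0.
have n2 : (1 < n)%N by lia.
have pq := pdiv_prime n2; set q := pdiv n in pq.
have qn : n = (q * (n %/ q))%N by rewrite mulnC divnK ?pdiv_dvd.
set n' := (n %/ q)%N in qn.
have q1 := prime_gt1 pq.
have n'0 : (0 < n')%N by lia.
have n'n : (n' < n)%N by nia.
have [m [T [m0 Tp n'E]]] := IH n' ltac:(lia) ltac:(lia).
have qz : (q.-1 < z)%N by have : (q <= n)%N := pdiv_leq n0; lia.
pose j := Ordinal qz; have wj : w j = q by rewrite /w /= prednK ?prime_gt0.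
have [jT|jT] := boolP (j \in T).
  exists (m * q)%N, (T :\ j); split.
  - have Tz : (weight w T >= q)%N.
      by rewrite /weight (big_setD1 j) //= wj leq_pmulr // prodn_cond_gt0.
    by nia.
  - by move=> i /setD1P[_ /Tp].
  - rewrite qn n'E /weight (big_setD1 j) //= wj -!mulnn; set x := (\prod_(i in _) _)%N.
    by move: x => x; lia.
exists m, (j |: T); split=> //.
- by move=> i /setU1P[->|/Tp //]; rewrite wj.
- by rewrite qn n'E /weight big_setU1 //= wj; lia.
Qed.

(** Each n <= z is m^2 a t with a | d and t a squarefree member of the family: the primes of the
    squarefree part that divide d go into a. Summing 1 / n then separates the three factors, and the
    sum of 1 / m^2 is at most 2. *)
Let mass_ge : \sum_(n < z) (n.+1)%:R^-1 <=
  2 * sum_inv_div R d * sieve_mass R P w z.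
Proof.
pose val (t : 'I_z * 'I_d.+1 * {set 'I_z}) : nat :=
  (t.1.1.+1 ^ 2 * t.1.2 * weight w t.2)%N.
pose ok (t : 'I_z * 'I_d.+1 * {set 'I_z}) :=
  (t.1.2 %| d)%N && (t.2 \in sieve_family P w z).
apply: (@le_trans _ _ (\sum_(t | ok t) (val t)%:R^-1)); last first.
  apply: (@le_trans _ _ ((\sum_(m < z) ((m.+1)%:R ^+ 2)^-1) * sum_inv_div R d *
     sieve_mass R P w z)); last first.
    rewrite !ler_wpM2r ?sum_inv_sqr_le //.
      by apply: sumr_ge0 => T _; rewrite invr_ge0.
    by apply: sumr_ge0 => a _; rewrite invr_ge0.
  rewrite /sum_inv_div /sieve_mass big_distrlr pair_big /= big_distrlr pair_big /=.
  rewrite le_eqVlt; apply/orP; left; apply/eqP.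
  apply: eq_bigr => -[[m a] T] _ /=.
  rewrite /val -[LHS]/(((m.+1 ^ 2 * a * weight w T)%N)%:R^-1).
  by rewrite natrM natrM natrX !invfM.
apply: (@le_trans _ _ (\sum_(n < z) \sum_(t | ok t) (val t == n.+1)%:R / (val t)%:R)).
  apply: ler_sum => n _.
  have [m [T [/andP[m0 mz] Tp nE]]] := @sqr_weight_decomp n.+1 (ltn_ord n).
  have mz' : (m.-1 < z)%N by lia.
  have mE : m.-1.+1 = m by lia.
  have wT : weight w T = (weight w (T :\: P) * weight w (T :&: P))%N.
    by rewrite /weight (big_setID P) /= mulnC.
  have aD : (weight w (T :\: P) %| d)%N.
    rewrite weight_dvd; last by move=> i /setDP[/Tp].
    apply/subsetP => i; rewrite !inE => /andP[+ iT].
    by have pi : prime i.+1 := Tp _ iT; rewrite pi /= negbK.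
  have aO : (weight w (T :\: P) < d.+1)%N by rewrite ltnS dvdn_leq.
  pose t0 : 'I_z * 'I_d.+1 * {set 'I_z} := (Ordinal mz', Ordinal aO, T :&: P).
  have vt0 : val t0 = n.+1 by rewrite /val /= mE nE wT mulnA.
  have ok0 : ok t0.
    rewrite /ok /= aD inE subsetIr /=; apply: leq_trans (ltn_ord n).
    rewrite nE wT mulnA leq_pmull // !muln_gt0 m0 /=.
    exact: dvdn_gt0 d_gt0 aD.
  rewrite (bigD1 t0) //= vt0 eqxx mul1r ler_wpDr // sumr_ge0 //.
rewrite exchange_big /=; apply: ler_sum => t _; rewrite -mulr_suml.
rewrite ler_piMl ?invr_ge0 // -natr_sum.
rewrite -[X in _ <= X]/(1%:R) ler_nat -big_mkcond sum1_card.
apply/card_le1_eqP => i j; rewrite -!topredE /= => /eqP-> /eqP[] ?; exact/ord_inj.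
Qed.

(** The mass is part of the expanded Euler product. With d = 1 this yields the divergence of the sum
    of 1/q over primes. *)
Lemma harmonic_le_prod : \sum_(n < z) (n.+1)%:R^-1 <=
  2 * sum_inv_div R d * \prod_(i < z | prime i.+1) (1 + (i.+1)%:R^-1).
Proof.
apply: (le_trans mass_ge); rewrite ler_wpM2l //.
  by rewrite mulr_ge0 // sumr_ge0 // => a _; rewrite invr_ge0.
apply: (@le_trans _ _ (\prod_(i in P) (1 + (i.+1)%:R^-1))).
  rewrite prod1D_subset /sieve_mass /sieve_family.
  under eq_bigl do rewrite inE.
  rewrite big_mkcondr /=; apply: ler_sum => T _.
  have WT : (weight w T)%:R^-1 = \prod_(i in T) (i.+1)%:R^-1 :> R.
    by rewrite /weight natr_prod -prodfV.
  by rewrite WT; case: ifP => // _; rewrite prodr_ge0 // => i _; rewrite invr_ge0.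
rewrite big_mkcond [leRHS]big_mkcond; apply: ler_prod => i _; rewrite inE.
have i1 : 1 <= 1 + (i.+1)%:R^-1 :> R by rewrite lerDl invr_ge0.
case: (prime _) => /=; last by rewrite ler01 lexx.
by case: ifP => _; rewrite ?ler01 ?i1 ?lexx ?andbT // (le_trans ler01 i1).
Qed.

(** By unique factorisation, [weight] is injective on the family, with values at most z. *)
Let card_sieve_family : (#|sieve_family P w z| <= z.+1)%N.
Proof.
rewrite -[z.+1]card_ord.
pose f (T : {set 'I_z}) : 'I_z.+1 := inord (weight w T).
suff finj : {in sieve_family P w z &, injective f}.
  by rewrite -(card_in_imset finj) max_card.
have mem i T : T \in sieve_family P w z -> (prime (w i) && (w i %| weight w T)%N) = (i \in T).
  rewrite inE => /andP[/subsetP TP _].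
  apply/andP/idP => [[pi]|iT]; last first.
    by move/TP: (iT); rewrite inE => /andP[-> _]; split=> //; rewrite /weight (big_setD1 i) //= dvdn_mulr.
  rewrite /weight Euclid_dvd_prod // big_orE => /existsP[j /andP[jT]].
  by move/TP: (jT); rewrite inE => /andP[pj _]; rewrite dvdn_prime2 // => /eqP[] /ord_inj ->.
move=> T U TF UF /(congr1 (@nat_of_ord _)); rewrite !inordK; last 2 first.
- by move: UF; rewrite inE => /andP[].
- by move: TF; rewrite inE => /andP[].
by move=> e; apply/setP => i; rewrite -(mem i T) // -(mem i U) // e.
Qed.

(** Primes up to z are counted trivially; a prime above z has no prime factor up to z and survives
    the sieve. *)
Let primes_le_sieve : #|[set p : 'I_N.+1 | prime p && (d %| p.-1 + u)%N]|%:R <=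
  z%:R + N%:R / d%:R / sieve_mass R P w z + (z.+1 * z)%:R ^+ 2.
Proof.
pose X := [set n : 'I_N.+1 | (0 < n)%N && (d %| n.-1 + u)%N].
pose D (n : 'I_N.+1) := [set i : 'I_z | (w i %| n)%N].
have x0 : 0 <= N%:R / d%:R :> R by rewrite mulr_ge0 ?invr_ge0.
have cnt (T : {set 'I_z}) : T \subset P ->
    `| #|[set j in X | T \subset D j]|%:R - N%:R / d%:R / (weight w T)%:R | <= 1 :> R.
  move=> TP.
  have Tp i : i \in T -> prime (w i) by move/(subsetP TP); rewrite inE => /andP[].
  have -> : [set j in X | T \subset D j] =
      [set n : 'I_N.+1 | [&& (0 < n)%N, (d %| n.-1 + u)%N & (weight w T %| n)%N]].
    by apply/setP => n; rewrite !inE weight_dvd // andbA.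
  apply: count_coprime_dvd => //; first by rewrite prodn_cond_gt0.
  rewrite /weight; apply: (big_ind (fun m => coprime d m)) => [|m m' cm cm'|i iT]; first by rewrite coprimen1.
    by rewrite coprimeMr cm.
  by rewrite coprime_sym prime_coprime ?Tp //; move/(subsetP TP): iT; rewrite inE => /andP[].
have := selberg_sieve w_gt0 z_gt0 cnt x0.
set S := [set j in X | _] => hS.
have sub : [set p : 'I_N.+1 | prime p && (d %| p.-1 + u)%N] \subset
    S :|: [set p : 'I_N.+1 | (0 < p <= z)%N].
  apply/subsetP => p; rewrite !inE => /andP[pp ->]; rewrite prime_gt0 //= ?andbT.
  case: leqP => //= zp; rewrite ?orbT // orbF.
  rewrite -setI_eq0; apply/eqP/setP => i; rewrite !inE; apply/negP => /andP[ip /andP[pi _]].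
  by move: ip; rewrite dvdn_prime2 // => /eqP ip; have := ltn_ord i; rewrite /w in ip; lia.
have cz : (#|[set p : 'I_N.+1 | (0 < p <= z)%N]| <= z)%N.
  have -> : [set p : 'I_N.+1 | (0 < p <= z)%N] =
      [set p in [set inord i.+1 | i : 'I_z] | (0 < p <= z)%N].
    apply/setP => p; rewrite !inE; case: (boolP (0 < p <= z)%N) => [/andP[p0 pz]|_]; rewrite ?andbF ?andbT //.
    have pz' : (p.-1 < z)%N by lia.
    symmetry; apply/imsetP; exists (Ordinal pz') => //.
    by apply/val_inj; rewrite /= inordK prednK.
  rewrite setIdE; apply: leq_trans (subset_leq_card (subsetIl _ _)) _.
  by apply: leq_trans (leq_imset_card _ _) _; rewrite card_ord.
have := leq_trans (subset_leq_card sub) (leq_card_setU _ _) => h.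
have {}h : #|[set p : 'I_N.+1 | prime p && (d %| p.-1 + u)%N]|%:R <= #|S|%:R + z%:R :> R.
  by rewrite -natrD ler_nat; apply: leq_trans h _; rewrite leq_add2l.
have hF : (#|sieve_family P w z| * z)%:R ^+ 2 <= (z.+1 * z)%:R ^+ 2 :> R.
  by rewrite -!natrX ler_nat leq_sqr leq_mul2r card_sieve_family orbT.
lra.
Qed.

(** The harmonic sum up to 2^k is at least k/2, so the mass is at least k / (4 sigma(d)/d); and z +
    (z (z+1))^2 <= 5 z^4. *)
Lemma primes_in_progression_le_harmonic (k : nat) :
  z = (2 ^ k)%N -> (0 < k)%N ->
  #|[set p : 'I_N.+1 | prime p && (d %| p.-1 + u)%N]|%:R <=
  4 * sum_inv_div R d * (N%:R / d%:R) / k%:R + 5 * z%:R ^+ 4.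
Proof.
move=> zE k0.
have z2 : 2 <= z%:R :> R by rewrite ler_nat zE -[2%N]/(2 ^ 1)%N leq_exp2l.
have := mass_ge; rewrite [in leLHS]zE => /(le_trans (harmonic_pow2_ge R k)).
have := primes_le_sieve; set G := sieve_mass _ _ _ _; set s := sum_inv_div R d.
set c := #|_|%:R; set y := N%:R / d%:R => h hG.
have y0 : 0 <= y by rewrite mulr_ge0 ?invr_ge0.
have kR : 0 < k%:R :> R by rewrite ltr0n.
have s0 : 0 <= s by apply: sumr_ge0 => a _; rewrite invr_ge0.
have G0 : 0 <= G by apply: sumr_ge0 => T _; rewrite invr_ge0.
have sG : 0 < s * G by have : 0 < k%:R / 2 :> R; [rewrite divr_gt0 | lra].
have {}G0 : 0 < G.
  by rewrite lt_neqAle G0 andbT eq_sym; apply: contraTneq sG => ->; rewrite mulr0 ltxx.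
apply: (le_trans h).
have e1 : y / G <= 4 * s * y / k%:R.
  rewrite ler_pdivrMr // mulrAC ler_pdivlMr //.
  have : y * k%:R <= y * (4 * (s * G)) by rewrite ler_wpM2l //; lra.
  by move/le_trans; apply; rewrite le_eqVlt; apply/orP; left; apply/eqP; ring.
have e2 : (z.+1 * z)%:R ^+ 2 <= 4 * z%:R ^+ 4 :> R.
  rewrite natrM -natr1.
  have : (z%:R + 1) * z%:R <= 2 * z%:R ^+ 2 :> R by nra.
  move=> hz; apply: (@le_trans _ _ ((2 * z%:R ^+ 2) ^+ 2)).
    by rewrite lerXn2r ?nnegrE //; nra.
  by rewrite le_eqVlt; apply/orP; left; apply/eqP; ring.
have e3 : z%:R <= z%:R ^+ 4 :> R by rewrite ler_eXnr //; lra.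
lra.
Qed.

End PrimesInProgression.

Lemma prod_primes_ge (R : realFieldType) (k : nat) :
  k%:R / 4 <= \prod_(i < 2 ^ k | prime i.+1) (1 + (i.+1)%:R^-1) :> R.
Proof.
have z0 : (0 < 2 ^ k)%N by rewrite expn_gt0.
have := le_trans (harmonic_pow2_ge R k) (harmonic_le_prod R (isT : 0 < 1)%N z0).
by rewrite sum_inv_div1; lra.
Qed.

Lemma primes_in_progression_le (R : realFieldType) (d u N k : nat) :
  (0 < d)%N -> (0 < k)%N ->
  #|[set p : 'I_N.+1 | prime p && (d %| p.-1 + u)%N]|%:R <=
  4 * sum_inv_div R d * (N%:R / d%:R) / k%:R + 5 * (2 ^ k)%:R ^+ 4.
Proof.
by move=> d0 k0; apply: primes_in_progression_le_harmonic; rewrite ?expn_gt0.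
Qed.

(** * Chebyshev's lower bound *)

(** Legendre's formula: each exponent k contributes floor(2n/p^k) - 2 floor(n/p^k), which is 0 or 1,
    and 0 once p^k > 2n. *)
Lemma logn_central_bin p n : prime p -> (0 < n)%N ->
  (logn p 'C(2 * n, n) <= trunc_log p (2 * n))%N.
Proof.
move=> pp n0.
have ext : (\sum_(1 <= k < n.+1) n %/ p ^ k = \sum_(1 <= k < (2 * n).+1) n %/ p ^ k)%N.
  rewrite [RHS](big_cat_nat _ (n := n.+1)) //=; last by lia.
  rewrite [X in (_ + X)%N]big_nat_cond [X in (_ + X)%N]big1 ?addn0 // => k.
  rewrite andbT => /andP[nk _]; rewrite divn_small //.
  by apply: (leq_trans (ltn_expl n (prime_gt1 pp))); rewrite leq_pexp2l ?prime_gt0 // ltnW.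
have e : (logn p 'C(2 * n, n) + 2 * logn p n`! = logn p (2 * n)`!)%N.
  have b : ('C(2 * n, n) * (n`! * n`!) = (2 * n)`!)%N.
    have nn : (n <= 2 * n)%N by lia.
    by have := bin_fact nn; have -> : (2 * n - n = n)%N by lia.
  by rewrite -b !lognM ?muln_gt0 ?fact_gt0 ?bin_gt0 //; lia.
move: e; rewrite !logn_fact // ext => e.
suff : (\sum_(1 <= k < (2 * n).+1) (2 * n) %/ p ^ k <=
   2 * (\sum_(1 <= k < (2 * n).+1) n %/ p ^ k) + trunc_log p (2 * n))%N by lia.
rewrite big_distrr /=.
apply: (@leq_trans (\sum_(1 <= k < (2 * n).+1)
   (2 * (n %/ p ^ k) + (k <= trunc_log p (2 * n))))%N).
  rewrite !big_nat; apply: leq_sum => k /andP[k1 _].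
  have pk0 : (0 < p ^ k)%N by rewrite expn_gt0 prime_gt0.
  case: (leqP k (trunc_log p (2 * n))) => [_|kt].
    have := divn_eq n (p ^ k); have := ltn_pmod n pk0.
    set a := (n %/ _)%N; set r := (n %% _)%N => hr hn.
    suff : ((2 * n) %/ p ^ k < (2 * a + 1).+1)%N by rewrite /=; lia.
    by rewrite ltn_divLR //; nia.
  rewrite divn_small //; have := trunc_log_ltn (2 * n) (prime_gt1 pp).
  by move/leq_trans; apply; rewrite leq_exp2l // prime_gt1.
rewrite big_split /= leq_add2l.
set t := trunc_log _ _.
suff -> : (\sum_(1 <= k < (2 * n).+1) (k <= t) = minn (2 * n) t)%N by rewrite geq_minr.
elim: (2 * n)%N => [|m IH]; first by rewrite big_geq ?min0n.
rewrite big_nat_recr //= IH; lia.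
Qed.

Lemma dvdn_fact_prime p n : prime p -> (p %| n`!)%N -> (p <= n)%N.
Proof.
move=> pp; elim: n => [|n IH]; first by rewrite dvdn1 => /eqP p1; rewrite p1 in pp.
by rewrite factS Euclid_dvdM // => /orP[/dvdn_leq->|/IH/leqW].
Qed.

Lemma central_bin_le n : (0 < n)%N ->
  ('C(2 * n, n) <= (2 * n) ^ #|[set p : 'I_(2 * n).+1 | prime p]|)%N.
Proof.
move=> n0; have c0 : (0 < 'C(2 * n, n))%N by rewrite bin_gt0; lia.
have small p : p \in primes 'C(2 * n, n) -> (p <= 2 * n)%N.
  rewrite mem_primes => /and3P[pp _ pd].
  have : (p %| (2 * n)`!)%N.
    have nn : (n <= 2 * n)%N by lia.
    by rewrite -(bin_fact nn) dvdn_mulr.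
  exact: dvdn_fact_prime.
rewrite {1}(prod_prime_decomp c0) prime_decompE big_map /=.
apply: (@leq_trans (\prod_(p <- primes 'C(2 * n, n)) (2 * n))%N).
  rewrite big_seq [leqRHS]big_seq; apply: leq_prod => p pP.
  have pp : prime p by move: pP; rewrite mem_primes => /and3P[].
  apply: (@leq_trans (p ^ trunc_log p (2 * n))).
    by rewrite leq_pexp2l ?prime_gt0 ?logn_central_bin.
  by apply: trunc_logP; [exact: prime_gt1 | lia].
rewrite big_const_seq count_predT iter_muln_1 leq_pexp2l //; first by lia.
rewrite cardE -(size_map val) uniq_leq_size ?primes_uniq // => p pP.
have pn : (p < (2 * n).+1)%N by rewrite ltnS small.
apply/mapP; exists (Ordinal pn) => //; rewrite mem_enum inE /=.
by move: pP; rewrite mem_primes => /and3P[].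
Qed.

Lemma bin_central_ge n : (2 ^ n <= 'C(2 * n, n))%N.
Proof.
elim: n => [|n IH]; first by rewrite bin0.
have -> : (2 * n.+1 = (2 * n).+2)%N by lia.
rewrite binS (binS (2 * n) n) expnS mul2n -addnn.
have : ('C(2 * n, n) <= 'C((2 * n).+1, n))%N by rewrite leq_bin2l.
lia.
Qed.

(** With n = N/2, compare 2^n <= C(2n, n) <= (2n)^pi(2n) <= 2^(L pi(N)). *)
Lemma chebyshev_lower N L : (N < 2 ^ L)%N ->
  (N %/ 2 <= L * #|[set p : 'I_N.+1 | prime p]|)%N.
Proof.
move=> NL; set n := (N %/ 2)%N; have [->//|n0] := posnP n.
have nN : (2 * n <= N)%N by rewrite mulnC leq_trunc_div.
have h := leq_trans (bin_central_ge n) (central_bin_le n0).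
rewrite -(leq_exp2l _ _ (isT : 1 < 2)%N) expnM; apply: (leq_trans h).
apply: (@leq_trans ((2 ^ L) ^ #|[set p : 'I_(2 * n).+1 | prime p]|)).
  case: (posnP #|[set p : 'I_(2 * n).+1 | prime p]|) => [->//|c0]; rewrite leq_exp2r //.
  exact: ltnW (leq_ltn_trans nN NL).
rewrite leq_pexp2l ?expn_gt0 //.
have le : ((2 * n).+1 <= N.+1)%N by [].
rewrite -(card_imset _ (_ : injective (widen_ord le))); last first.
  by move=> i j /(congr1 val) /= /val_inj.
rewrite subset_leq_card //.
by apply/subsetP => p /imsetP[q]; rewrite !inE => qp ->.
Qed.

(** * Prime factors from a finite set *)

Definition omega_in (Q : seq nat) (n : nat) : nat := count (dvdn^~ n) Q.

Lemma omega_in_mul Q a b : (omega_in Q b <= omega_in Q (a * b))%N.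
Proof. by apply: sub_count => q /= qb; rewrite dvdn_mull. Qed.

Lemma sum_multiples (R : nmodType) (F : nat -> R) q Y : (0 < q)%N ->
  \sum_(b < Y | (q %| b.+1)%N) F b.+1 = \sum_(b < Y %/ q) F (q * b.+1)%N.
Proof.
move=> q0; elim: Y => [|Y IH]; first by rewrite div0n !big_ord0.
rewrite big_mkcond big_ord_recr /= -big_mkcond IH divnS //.
case: (boolP (q %| Y.+1)%N) => /= qY; last by rewrite addr0 add0n.
rewrite big_ord_recr /=; congr (_ + F _).
by have := divnS Y q0; rewrite qY /= add1n => <-; rewrite mulnC divnK.
Qed.

Section Moments.
Variable R : realFieldType.

(** Induction on Q: a new prime q replaces 1 by 1 - 1/4 at the multiples of q, and dividing those by
    q leaves the other primes of Q unaffected. An error e >= 1 becomes at most e + (e + 1)/4 <=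
    2e. *)
Lemma sum_omega_in (Q : seq nat) (Y : nat) : uniq Q -> all prime Q ->
  `| \sum_(b < Y) (3/4) ^+ omega_in Q b.+1 - Y%:R * \prod_(q <- Q) (1 - (4 * q%:R)^-1) |
    <= (2 ^ size Q)%:R :> R.
Proof.
move=> uQ pQ; elim: Q uQ pQ Y => [|q Q IH] /= => [_ _ Y|/andP[qQ uQ] /andP[pq pQ] Y].
  rewrite big_nil mulr1 /omega_in /=; under eq_bigr do rewrite expr0.
  by rewrite sumr_const card_ord subrr normr0.
have q0 := prime_gt0 pq.
set Wt := \prod_(q <- Q) _ in IH.
have W01 : 0 <= Wt <= 1.
  rewrite /Wt big_seq; apply: (big_ind (fun x : R => 0 <= x <= 1)) => [|x y|q' q'Q].
  - by rewrite ler01 lexx.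
  - by move=> /andP[x0 x1] /andP[y0 y1]; rewrite mulr_ge0 // mulr_ile1.
  have q'1 : 1 <= q'%:R :> R by rewrite ler1n prime_gt0 // (allP pQ).
  rewrite gerBl invr_ge0 mulr_ge0 // andbT subr_ge0 invf_le1 ?mulr_gt0 //; lra.
have -> : \sum_(b < Y) (3/4) ^+ omega_in (q :: Q) b.+1 =
    \sum_(b < Y) (3/4) ^+ omega_in Q b.+1 - 4^-1 * \sum_(b < Y %/ q) (3/4) ^+ omega_in Q b.+1 :> R.
  have -> : \sum_(b < Y %/ q) (3/4) ^+ omega_in Q b.+1 =
      \sum_(b < Y | (q %| b.+1)%N) (3/4) ^+ omega_in Q b.+1 :> R.
    rewrite (sum_multiples (fun n => (3/4) ^+ omega_in Q n : R)) //.
    apply: eq_bigr => b _; congr (_ ^+ _); apply: eq_in_count => q' q'Q /=.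
    have pq' : prime q' := allP pQ _ q'Q.
    rewrite Euclid_dvdM // (dvdn_prime2 pq' pq).
    by case: (q' =P q) => [e|//]; case/negP: qQ; rewrite -e.
  rewrite [X in _ - _ * X]big_mkcond mulr_sumr -sumrB; apply: eq_bigr => b _ /=.
  by rewrite /omega_in /=; case: (q %| b.+1)%N; rewrite ?add0n ?add1n ?exprS ?mulr0 ?subr0 //; field.
rewrite big_cons -/Wt.
have /andP[W0 W1] := W01.
have h1 := IH uQ pQ Y; have h2 := IH uQ pQ (Y %/ q)%N.
move: h1 h2; set A := \sum_(b < Y) _; set B := \sum_(b < Y %/ q) _ => h1 h2.
have qR : 0 < q%:R :> R by rewrite ltr0n.
have h3 : `| (Y %/ q)%:R * Wt - Y%:R / q%:R * Wt | <= 1.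
  rewrite -mulrBl normrM (ger0_norm W0) mulr_ile1 ?normr_ge0 //.
  rewrite -(ler_pM2r qR) mul1r -[X in _ * X <= _](gtr0_norm qR) -normrM mulrBl divfK ?gt_eqF //.
  have := divn_eq Y q; have := ltn_pmod Y q0 => lt e.
  rewrite {2}e natrD natrM opprD addrA subrr sub0r normrN ger0_norm // ler_nat.
  exact: ltnW.
have -> : A - 4^-1 * B - Y%:R * ((1 - (4 * q%:R)^-1) * Wt) =
    (A - Y%:R * Wt) - 4^-1 * ((B - (Y %/ q)%:R * Wt) + ((Y %/ q)%:R * Wt - Y%:R / q%:R * Wt)).
  by field; rewrite gt_eqF.
apply: le_trans (ler_normB _ _) _.
rewrite expnS natrM normrM ger0_norm ?invr_ge0 //.
have h4 := ler_normD (B - (Y %/ q)%:R * Wt) ((Y %/ q)%:R * Wt - Y%:R / q%:R * Wt).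
have s1 : 1 <= (2 ^ size Q)%:R :> R by rewrite ler1n expn_gt0.
lra.
Qed.

Lemma harmonic_le (Y L : nat) : (Y <= 2 ^ L)%N ->
  \sum_(a < Y) (a.+1)%:R^-1 <= L.+1%:R :> R.
Proof.
move=> YL; apply: (@le_trans _ _ (\sum_(a < 2 ^ L) (a.+1)%:R^-1)).
  rewrite -!(big_mkord xpredT (fun a => (a.+1)%:R^-1)).
  by rewrite [leRHS](big_cat_nat _ YL) //= lerDl sumr_ge0 // => i _; rewrite invr_ge0.
elim: L {Y YL} => [|L IH]; first by rewrite expn0 big_ord1 invr1.
have -> : (2 ^ L.+1 = 2 ^ L + 2 ^ L)%N by rewrite expnS mul2n addnn.
rewrite big_split_ord /= -natr1; apply: lerD => //.
have k0 : 0 < (2 ^ L)%:R :> R by rewrite ltr0n expn_gt0.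
apply: (@le_trans _ _ (\sum_(i < 2 ^ L) (2 ^ L)%:R^-1)).
  by apply: ler_sum => i _; rewrite lef_pV2 ?posrE // ler_nat -addnS leq_addr.
by rewrite sumr_const card_ord -[leLHS]mulr_natr mulVf ?gt_eqF.
Qed.

Lemma sum_inv_divE n Y : (0 < n <= Y)%N ->
  sum_inv_div R n = \sum_(a < Y | (a.+1 %| n)%N) (a.+1)%:R^-1.
Proof.
move=> /andP[n0 nY]; rewrite /sum_inv_div big_mkcond big_ord_recl /= dvd0n gtn_eqF // add0r.
rewrite [RHS]big_mkcond /=.
rewrite -!(big_mkord xpredT (fun a => if (a.+1 %| n)%N then a.+1%:R^-1 else 0 : R)).
rewrite [RHS](big_cat_nat _ (n := n)) //= [X in _ = _ + X]big_nat [X in _ = _ + X]big1 ?addr0 //.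
by move=> a /andP[da _]; rewrite gtnNdvd.
Qed.

(** Write d = a b with a the summed divisor and forget the primes of a, which only increases
    (3/4)^omega. The main terms then carry the sum of 1/a^2 and the errors the sum of 1/a. *)
Lemma sum_inv_div_omega (Q : seq nat) (Y L : nat) :
  uniq Q -> all prime Q -> (Y <= 2 ^ L)%N ->
  \sum_(d < Y) (3/4) ^+ omega_in Q d.+1 * sum_inv_div R d.+1 <=
    2 * Y%:R * \prod_(q <- Q) (1 - (4 * q%:R)^-1) + (2 ^ size Q * L.+1)%:R.
Proof.
move=> uQ pQ YL; set Wt := \prod_(q <- Q) _.
have F0 n : 0 <= (3/4) ^+ n :> R by rewrite exprn_ge0 //; lra.
have -> : \sum_(d < Y) (3/4) ^+ omega_in Q d.+1 * sum_inv_div R d.+1 =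
    \sum_(a < Y) (a.+1)%:R^-1 * \sum_(b < Y %/ a.+1) (3/4) ^+ omega_in Q (a.+1 * b.+1).
  transitivity (\sum_(d < Y) \sum_(a < Y | (a.+1 %| d.+1)%N)
      (a.+1)%:R^-1 * (3/4) ^+ omega_in Q d.+1 : R).
    apply: eq_bigr => d _; rewrite -mulr_suml mulrC; congr (_ * _).
    by apply: sum_inv_divE; rewrite ltn_ord.
  rewrite (exchange_big_dep xpredT) //=; apply: eq_bigr => a _.
  by rewrite -mulr_sumr (sum_multiples (fun n => (3/4) ^+ omega_in Q n : R)).
apply: (@le_trans _ _ (\sum_(a < Y) (a.+1)%:R^-1 * (Y%:R / (a.+1)%:R * Wt + (2 ^ size Q)%:R))).
  apply: ler_sum => a _; rewrite ler_wpM2l ?invr_ge0 //.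
  apply: (@le_trans _ _ (\sum_(b < Y %/ a.+1) (3/4) ^+ omega_in Q b.+1)).
    apply: ler_sum => b _; rewrite ler_wiXn2l ?omega_in_mul //; lra.
  have := sum_omega_in (Y %/ a.+1) uQ pQ; rewrite -/Wt ler_norml => /andP[_].
  rewrite lerBlDl => /le_trans; apply; rewrite lerD2r ler_wpM2r //.
    rewrite /Wt big_seq prodr_ge0 // => q qQ.
    have q1 : 1 <= q%:R :> R by rewrite ler1n prime_gt0 // (allP pQ).
    by rewrite subr_ge0 invf_le1 ?mulr_gt0 //; lra.
  by rewrite ler_pdivlMr ?ltr0n // -natrM ler_nat leq_trunc_div.
under eq_bigr do rewrite mulrDr.
rewrite big_split /= -mulr_suml; apply: lerD; last first.
  rewrite natrM mulrC ler_wpM2l //; exact: harmonic_le.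
have -> : \sum_(a < Y) (a.+1)%:R^-1 * (Y%:R / (a.+1)%:R * Wt) =
   (\sum_(a < Y) ((a.+1)%:R ^+ 2)^-1) * (Y%:R * Wt) :> R.
  by rewrite mulr_suml; apply: eq_bigr => a _; rewrite expr2 invfM; ring.
rewrite -mulrA ler_wpM2r ?sum_inv_sqr_le //.
rewrite mulr_ge0 // /Wt big_seq prodr_ge0 // => q qQ.
have q1 : 1 <= q%:R :> R by rewrite ler1n prime_gt0 // (allP pQ).
by rewrite subr_ge0 invf_le1 ?mulr_gt0 //; lra.
Qed.

(** Rankin's trick: (4/3)^G (3/4)^omega is at least 1 when omega < G. *)
Lemma sum_inv_div_few (Q : seq nat) (Y L G : nat) :
  uniq Q -> all prime Q -> (Y <= 2 ^ L)%N ->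
  \sum_(d < Y | (omega_in Q d.+1 < G)%N) sum_inv_div R d.+1 <=
    (4/3) ^+ G * (2 * Y%:R * \prod_(q <- Q) (1 - (4 * q%:R)^-1) + (2 ^ size Q * L.+1)%:R).
Proof.
move=> uQ pQ YL; have h := sum_inv_div_omega uQ pQ YL.
have s0 d : 0 <= sum_inv_div R d by apply: sumr_ge0 => a _; rewrite invr_ge0.
apply: (@le_trans _ _ ((4/3) ^+ G *
    \sum_(d < Y) (3/4) ^+ omega_in Q d.+1 * sum_inv_div R d.+1)); last first.
  by rewrite ler_wpM2l // exprn_ge0 //; lra.
rewrite mulr_sumr big_mkcond /=; apply: ler_sum => d _.
rewrite mulrA; case: ifP => [dG|_]; last first.
  by rewrite !mulr_ge0 // exprn_ge0 //; lra.
rewrite ler_peMl // -(subnK (ltnW dG)) exprD -mulrA -exprMn.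
have -> : 4/3 * (3/4) = 1 :> R by field.
by rewrite expr1n mulr1 exprn_ege1 //; lra.
Qed.

Lemma sum_inv_divM q m : prime q -> (0 < m)%N ->
  sum_inv_div R (q * m) <= (1 + q%:R^-1) * sum_inv_div R m.
Proof.
move=> pq m0; have q0 := prime_gt0 pq.
rewrite mulrDl mul1r.
rewrite (@sum_inv_divE (q * m)%N (q * m)%N) ?muln_gt0 ?q0 ?m0 ?leqnn //.
rewrite {1}(@sum_inv_divE m (q * m)%N) ?m0 ?leq_pmull // (@sum_inv_divE m m) ?m0 ?leqnn //.
have -> : q%:R^-1 * \sum_(a < m | (a.+1 %| m)%N) (a.+1)%:R^-1 =
   \sum_(a < q * m | (q %| a.+1)%N && (a.+1 %/ q %| m)%N) (a.+1)%:R^-1 :> R.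
  rewrite big_mkcondr /= (sum_multiples (fun n => if (n %/ q %| m)%N then n%:R^-1 else 0 : R)) //.
  rewrite mulKn // mulr_sumr big_mkcond /=; apply: eq_bigr => a _.
  by rewrite mulKn //; case: ifP => // _; rewrite natrM invfM.
rewrite [X in _ <= X + _]big_mkcond [X in _ <= _ + X]big_mkcond -big_split [leLHS]big_mkcond /=.
apply: ler_sum => a _.
case: ifP => [aqm|_]; last by rewrite addr_ge0 //; case: ifP => // _; rewrite invr_ge0.
have [qa|qa] := boolP (q %| a.+1)%N.
  have -> /= : (a.+1 %/ q %| m)%N by rewrite -(dvdn_pmul2l q0) mulnC divnK.
  by rewrite lerDr; case: ifP => // _; rewrite invr_ge0.
have -> : (a.+1 %| m)%N.
  by move: aqm; rewrite Gauss_dvdr // coprime_sym prime_coprime.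
by rewrite addr0.
Qed.

Lemma sum_inv_div_prod (T : seq nat) : all prime T ->
  sum_inv_div R (\prod_(q <- T) q)%N <= \prod_(q <- T) (1 + q%:R^-1).
Proof.
elim: T => [|q T IH] /= => [_|/andP[pq pT]].
  by rewrite !big_nil sum_inv_div1.
rewrite !big_cons; apply: le_trans (sum_inv_divM pq _) _.
  by rewrite big_seq prodn_cond_gt0 // => i iT; rewrite prime_gt0 // (allP pT).
by rewrite ler_wpM2l ?IH // addr_ge0 // invr_ge0.
Qed.

Lemma primes_omega_moment (Q0 : seq nat) (N u : nat) (K : R) : uniq Q0 -> all prime Q0 -> 0 <= K ->
  (forall T : seq nat, uniq T -> {subset T <= Q0} ->
    #|[set p : 'I_N.+1 | prime p && (\prod_(q <- T) q %| p.-1 + u)%N]|%:R <=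
      K * \prod_(q <- T) ((1 + q%:R^-1) / q%:R)) ->
  \sum_(p < N.+1 | prime p) (4/3) ^+ omega_in Q0 (p.-1 + u)
    <= K * \prod_(q <- Q0) (1 + (1 + q%:R^-1) / q%:R / 3) :> R.
Proof.
move=> uQ0 pQ0 K0 H.
(* T collects the primes already required to divide p - 1 + u. Each q in Q moves into T or is
   dropped, since (4/3)^[q | n] = 1 + [q | n] / 3. *)
suff claim Q T : uniq (T ++ Q) -> {subset T ++ Q <= Q0} ->
    \sum_(p < N.+1 | prime p && (\prod_(q <- T) q %| p.-1 + u)%N) (4/3) ^+ omega_in Q (p.-1 + u)
      <= K * \prod_(q <- T) ((1 + q%:R^-1) / q%:R) *
        \prod_(q <- Q) (1 + (1 + q%:R^-1) / q%:R / 3) :> R.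
  have := claim Q0 [::] uQ0 (fun _ => id); rewrite !big_nil mulr1.
  rewrite (eq_bigl (fun p : 'I_N.+1 => prime p)) // => p.
  by rewrite ?big_nil dvd1n andbT.
elim: Q T => [|q Q IH] T.
  rewrite cats0 big_nil mulr1 => uT sT; rewrite /omega_in /=.
  under eq_bigr do rewrite expr0.
  rewrite sumr_const; apply: le_trans (H T uT sT).
  by rewrite cardsE.
move=> uTQ sTQ.
have uTQ' : uniq ((q :: T) ++ Q).
  rewrite -cat_rcons in uTQ.
  by rewrite -(perm_uniq (s1 := rcons T q ++ Q)) // perm_cat2r perm_rcons.
have sTQ' : {subset (q :: T) ++ Q <= Q0}.
  by move=> x; rewrite /= inE mem_cat => /or3P[/eqP->|xT|xQ]; apply: sTQ;
     rewrite mem_cat inE ?eqxx ?xT ?xQ ?orbT.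
have uTQ2 : uniq (T ++ Q) by move: uTQ' => /= /andP[].
have sTQ2 : {subset T ++ Q <= Q0} by move=> x xTQ; apply: sTQ'; rewrite /= inE xTQ orbT.
have h1 := IH T uTQ2 sTQ2; have h2 := IH (q :: T) uTQ' sTQ'.
have step : \sum_(p < N.+1 | prime p && (\prod_(q <- T) q %| p.-1 + u)%N)
      (4/3) ^+ omega_in (q :: Q) (p.-1 + u) =
   \sum_(p < N.+1 | prime p && (\prod_(q <- T) q %| p.-1 + u)%N) (4/3) ^+ omega_in Q (p.-1 + u)
   + 3^-1 * \sum_(p < N.+1 | prime p && (\prod_(q <- q :: T) q %| p.-1 + u)%N)
      (4/3) ^+ omega_in Q (p.-1 + u) :> R.
  rewrite [X in _ + 3^-1 * X](eq_bigl (fun p : 'I_N.+1 => (prime p && (\prod_(q <- T) q %| p.-1 + u)%N)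
      && (q %| p.-1 + u)%N)); last first.
    move=> p; rewrite big_cons Gauss_dvd; first by rewrite -andbA; congr andb; rewrite andbC.
    have pq : prime q by apply: (allP pQ0); apply: sTQ'; rewrite inE eqxx.
    rewrite big_seq; apply: (big_ind (fun m => coprime q m)) => [|m m' cm cm'|q' q'T].
    - by rewrite coprimen1.
    - by rewrite coprimeMr cm.
    rewrite prime_coprime // dvdn_prime2 //; last first.
      by apply: (allP pQ0); apply: sTQ'; rewrite inE mem_cat q'T orbT.
    by apply: contraTneq uTQ' => ->; rewrite /= mem_cat q'T.
  rewrite [X in _ + 3^-1 * X]big_mkcondr mulr_sumr -big_split; apply: eq_bigr => p _ /=.
  rewrite /omega_in /=; case: (q %| _)%N; rewrite ?mulr0 ?addr0 ?add0n // add1n exprS; by field.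
rewrite step; move: h1 h2; rewrite !big_cons.
set a := \sum_(p < _ | _) _; set b := \sum_(p < _ | _) _; set c := \prod_(q <- T) _.
set e := \prod_(q <- Q) _; set f := (1 + q%:R^-1) / q%:R => h1 h2.
have -> : K * c * ((1 + f / 3) * e) = K * c * e + 3^-1 * (K * (f * c) * e) by ring.
by apply: lerD => //; rewrite ler_pM2l ?invr_gt0.
Qed.

End Moments.

(** * Choice of the finite set Q and of the threshold G *)

Section ChoiceOfPrimes.
Variable R : realType.

Let inv_primes (a n : nat) : R := \sum_(a <= q < n | prime q) q%:R^-1.

(** By 1 + x <= exp x, [prod_primes_ge] bounds exp of the sum of 1/q from below by k/4. The 4 is
    paid by the extra 2 in the exponent, as e^2 >= 4. *)
Let inv_primes_unbounded a (B : R) : exists n, B <= inv_primes a n.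
Proof.
pose c := \sum_(0 <= q < a | prime q) q%:R^-1 : R.
have [k hk] : exists k : nat, expR (B + c) <= k%:R / 4.
  have := archi_boundP (ltW (expR_gt0 (B + c + 2))); set k := Num.bound _ => hk.
  exists k; have : expR (B + c) * 4 <= expR (B + c + 2).
    rewrite (expRD (B + c) 2) ler_pM2l ?expR_gt0 //.
    have -> : 2 = 1 + 1 :> R by ring.
    rewrite expRD; have := @expR_ge1Dx R 1 => h; nra.
  lra.
exists (2 ^ k).+1.
have h : k%:R / 4 <= expR (\sum_(0 <= q < (2 ^ k).+1 | prime q) q%:R^-1) :> R.
  apply: (le_trans (prod_primes_ge R k)).
  rewrite expR_sum [leRHS]big_mkcond big_nat_recl //= mul1r big_mkord [leLHS]big_mkcond /=.
  apply: ler_prod => i _; case: ifP => _; last by rewrite ler01 lexx.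
  by rewrite addr_ge0 ?invr_ge0 //= expR_ge1Dx.
have := le_trans hk h; rewrite ler_expR => {}h.
have [an|na] := leqP a (2 ^ k).+1.
  by move: h; rewrite (big_cat_nat _ an) //= -/c /inv_primes; lra.
have : \sum_(0 <= q < (2 ^ k).+1 | prime q) q%:R^-1 <= c.
  rewrite /c [leRHS](big_cat_nat _ (ltnW na)) //= lerDl.
  by apply: sumr_ge0 => q _; rewrite invr_ge0.

have : 0 <= inv_primes a (2 ^ k).+1 by rewrite /inv_primes sumr_ge0 // => q _; rewrite invr_ge0.
lra.
Qed.

Let inv_primes_window a (B : R) : (0 < a)%N -> 0 <= B ->
  exists n, B <= inv_primes a n <= B + 1.
Proof.
move=> a0 B0.
have ex : exists n, B <= inv_primes a n by exact: inv_primes_unbounded.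
exists (ex_minn ex); case: ex_minnP => -[|n] hn minn; rewrite hn /=.
  by rewrite /inv_primes big_geq // addr_ge0.
have [na|an] := ltnP n a.
  by rewrite /inv_primes big_geq // addr_ge0.
have hn' : inv_primes a n < B by rewrite ltNge; apply/negP => /minn; rewrite ltnn.
have : inv_primes a n.+1 <= inv_primes a n + 1.
  rewrite /inv_primes big_mkcond big_nat_recr //= -big_mkcond lerD2l.
  case: ifP => // pn; rewrite invf_le1 ?ltr0n ?ler1n ?prime_gt0 //.
lra.
Qed.

Let sum_inv_sqr_tail a n : (0 < a)%N -> \sum_(a <= q < n) (q%:R ^+ 2)^-1 <= 2 / a%:R :> R.
Proof.
move=> a0; have aR : 0 < a%:R :> R by rewrite ltr0n.
have [na|an] := leqP n a; first by rewrite big_geq // divr_ge0 // ltW.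
suff : \sum_(a <= q < n) (q%:R ^+ 2)^-1 <= 2 / a%:R - (n.-1)%:R^-1 :> R.
  by move/le_trans; apply; rewrite gerBl invr_ge0.
case: n an => // n; rewrite ltnS => an /=.
rewrite -(subnKC an); elim: (n - a)%N => [|m IH].
  rewrite addn0 big_nat1.
  have -> : 2 / a%:R - a%:R^-1 = a%:R^-1 :> R by field; rewrite gt_eqF.
  by rewrite lef_pV2 ?posrE ?exprn_gt0 // ler_eXnr // ler1n.
rewrite addnS big_nat_recr ?leqW ?leq_addr //=; apply: (le_trans (lerD IH (lexx _))).
have n0 : 0 < (a + m)%:R :> R by rewrite ltr0n addn_gt0 a0.
have -> : (a + m).+1%:R = (a + m)%:R + 1 :> R by rewrite -natr1.
set x := (a + m)%:R in n0 *.
rewrite -addrA lerD2l -subr_ge0.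
have -> : - (x + 1)^-1 - (- x^-1 + ((x + 1) ^+ 2)^-1) = (x * (x + 1) ^+ 2)^-1.
  by field; rewrite !gt_eqF //; lra.
by rewrite invr_ge0 mulr_ge0 ?exprn_ge0 //; lra.
Qed.

Let small_power (rho C tau : R) : 0 <= rho < 1 -> 0 < tau -> exists j, C * rho ^+ j <= tau.
Proof.
move=> /andP[r0 r1] t0.
have : ((fun j => C * rho ^+ j : R) @ \oo --> (C * 0 : R))%classic.
  by apply: cvgMr; apply: cvg_expr; rewrite ger0_norm.
rewrite mulr0 => /cvgrPdist_le /(_ _ t0) [j _ hj].
exists j; have := hj j (leqnn j); rewrite sub0r normrN; apply: le_trans; exact: ler_norm.
Qed.

(* With S the sum of 1/q over Q, S in [10j, 10j+1] and G = 7j, the first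
   product is at most exp(-S/4) and the second at most exp((S + 1)/3). *)
Lemma choice_of_primes (tau : R) : 0 < tau -> exists (Q : seq nat) (G : nat),
  [/\ uniq Q, all prime Q, \sum_(q <- Q) (q%:R ^+ 2)^-1 <= tau,
      (4/3) ^+ G * \prod_(q <- Q) (1 - (4 * q%:R)^-1) <= tau &
      (3/4) ^+ (2 * G) * \prod_(q <- Q) (1 + (1 + q%:R^-1) / q%:R / 3) <= tau].
Proof.
move=> t0.
have [a a2] : exists a : nat, (0 < a)%N && (2 / a%:R <= Num.min tau 1).
  pose a := (Num.bound (2 / Num.min tau 1)).+1.
  have m0 : 0 < Num.min tau 1 by rewrite lt_min t0 ltr01.
  have ha : 2 / Num.min tau 1 < a%:R.
    apply: lt_le_trans (archi_boundP _) _; first by rewrite divr_ge0 // ltW.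
    by rewrite ler_nat.
  exists a; rewrite /= ler_pdivrMr ?ltr0n // mulrC -ler_pdivrMr // ltW //.
have /andP[a0] := a2; rewrite le_min => /andP[a_tau a_1].
(* Decay rates per unit of j, from e^(5/2) >= (3/2)^5 and e^(10/3) <= (6/5)^20; both entries are
   below 1, the first only barely (about 0.986). *)
pose rho : R := Num.max ((4/3) ^+ 7 / (3/2) ^+ 5) ((3/4) ^+ 14 * (6/5) ^+ 20).
have rho01 : 0 <= rho < 1.
  apply/andP; split; first by rewrite le_max divr_ge0 // exprn_ge0 //; lra.
  by rewrite gt_max; apply/andP; split; [rewrite ltr_pdivrMr|]; lra.
have [j hj] := small_power (expR 1) rho01 t0.
have [n /andP[S1 S2]] := inv_primes_window a0 (ler0n R (10 * j)).
pose Q := [seq q <- index_iota a n | prime q].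
have bigQ (F : nat -> R) : \sum_(q <- Q) F q = \sum_(a <= q < n | prime q) F q by rewrite big_filter.
have sqr : \sum_(q <- Q) (q%:R ^+ 2)^-1 <= 2 / a%:R :> R.
  apply: le_trans (sum_inv_sqr_tail n a0); rewrite bigQ big_mkcond; apply: ler_sum => q _.
  by case: ifP => // _; rewrite invr_ge0 exprn_ge0.
have pQ : all prime Q by rewrite filter_all.
exists Q, (7 * j)%N; split=> //.
- by rewrite filter_uniq ?iota_uniq.
- exact: le_trans a_tau.
- apply: le_trans hj.
  have rj0 : 0 <= rho ^+ j by rewrite exprn_ge0 //; case/andP: rho01.
  apply: (@le_trans _ _ (rho ^+ j)); last by rewrite ler_peMl // -expR0 ler_expR.
  have W : \prod_(q <- Q) (1 - (4 * q%:R)^-1) <= expR (- (5 / 2)) ^+ j :> R.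
    apply: (@le_trans _ _ (expR (\sum_(q <- Q) - (4 * q%:R)^-1))).
      rewrite expR_sum big_seq [leRHS]big_seq; apply: ler_prod => q qQ.
      rewrite expR_ge1Dx andbT subr_ge0 invf_le1.
        by rewrite -natrM ler1n muln_gt0 /= prime_gt0 // (allP pQ).
      by rewrite -natrM ltr0n muln_gt0 /= prime_gt0 // (allP pQ).
    rewrite -expRM_natl ler_expR sumrN.
    have -> : \sum_(q <- Q) (4 * q%:R)^-1 = 4^-1 * inv_primes a n :> R.
      by rewrite /inv_primes -bigQ mulr_sumr; apply: eq_bigr => q _; rewrite invfM.
    by move: S1; rewrite natrM; lra.
  have e52 : expR (- (5 / 2)) <= ((3/2) ^+ 5)^-1 :> R.
    have e0 : 0 < (3/2) ^+ 5 :> R by rewrite exprn_gt0 //; lra.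
    rewrite expRN lef_pV2 ?posrE ?expR_gt0 //.
    have -> : 5 / 2 = 5%:R * (1 / 2) :> R by field.
    have h := @expR_ge1Dx R (1/2).
    rewrite expRM_natl lerXn2r ?nnegrE ?expR_ge0 //; lra.
  apply: (@le_trans _ _ (((4/3) ^+ 7 / (3/2) ^+ 5) ^+ j)).
    rewrite exprM [leRHS]exprMn ler_wpM2l ?exprn_ge0 //.
    apply: (le_trans W); rewrite lerXn2r ?nnegrE ?expR_ge0 // invr_ge0 exprn_ge0 //; lra.
  rewrite lerXn2r ?nnegrE ?le_max ?lexx ?orbT //.
  by rewrite divr_ge0 ?exprn_ge0.
- apply: le_trans hj.
  (* S <= 10j + 1 and sum of 1/q^2 <= 1 give the exponent (10j + 2)/3; its constant part is absorbed
     by [expR 1]. *)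
  have V : \prod_(q <- Q) (1 + (1 + q%:R^-1) / q%:R / 3) <=
      expR 1 * expR (10 / 3) ^+ j :> R.
    apply: (@le_trans _ _ (expR (\sum_(q <- Q) (1 + q%:R^-1) / q%:R / 3))).
      rewrite expR_sum; apply: ler_prod => q _; rewrite expR_ge1Dx andbT.
      by rewrite addr_ge0 // !mulr_ge0 ?addr_ge0 ?invr_ge0.
    rewrite -expRM_natl -expRD ler_expR.
    have -> : \sum_(q <- Q) (1 + q%:R^-1) / q%:R / 3 =
        3^-1 * (inv_primes a n + \sum_(q <- Q) (q%:R ^+ 2)^-1) :> R.
      rewrite /inv_primes -bigQ -big_split mulr_sumr; apply: eq_bigr => q _ /=.
      by rewrite expr2 invfM; ring.
    by move: S2; rewrite natrM; lra.
  have e103 : expR (10 / 3) <= (6/5) ^+ 20 :> R.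
    have -> : 10 / 3 = 20%:R * (1 / 6) :> R by field.
    have e16 : expR (1 / 6) <= 6/5 :> R.
      have := @expR_ge1Dx R (- (1/6)); rewrite expRN => h.
      have e0 := expR_gt0 (1/6 : R).
      have : (1 - 1/6) * expR (1/6) <= 1 :> R by rewrite -ler_pdivlMr // [leRHS]div1r.
      lra.
    by rewrite expRM_natl lerXn2r ?nnegrE ?expR_ge0.
  have -> : (3/4) ^+ (2 * (7 * j)) = ((3/4) ^+ 14) ^+ j :> R.
    by rewrite mulnA exprM.
  apply: (@le_trans _ _ (expR 1 * (((3/4) ^+ 14 * (6/5) ^+ 20) ^+ j))).
    rewrite [X in _ <= _ * X]exprMn [leRHS]mulrCA ler_wpM2l ?exprn_ge0 //.
    apply: (le_trans V); rewrite ler_wpM2l ?expR_ge0 // lerXn2r ?nnegrE ?expR_ge0 //.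
  rewrite ler_wpM2l ?expR_ge0 // lerXn2r ?nnegrE ?le_max ?lexx ?orbT //.
  by rewrite mulr_ge0 ?exprn_ge0 ?orbT.
Qed.

End ChoiceOfPrimes.

(** * Primes of small rank of apparition *)

Lemma card_exists_le (T : finType) (X : {set T}) (Y : nat) (r : nat -> pred T) :
  (forall x, x \in X -> exists2 d, (d < Y)%N & r d x) ->
  (#|X| <= \sum_(d < Y) #|[set x | r d x]|)%N.
Proof.
move=> h; rewrite -sum1_card.
apply: (@leq_trans (\sum_(x in X) \sum_(d < Y) r d x)%N).
  apply: leq_sum => x /h[d dY rdx].
  by rewrite (bigD1 (Ordinal dY)) //= rdx.
rewrite exchange_big; apply: leq_sum => d _ /=.
rewrite -sum1_card big_mkcond [leqRHS]big_mkcond; apply: leq_sum => x _.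
by rewrite inE; case: (x \in X); case: (r d x).
Qed.

Lemma fib_gt0 d : (0 < d)%N -> (0 < fib d)%N.
Proof. by elim/nat_ind2: d => // n IH1 IH2 _; rewrite fibSS ltn_addr // IH2. Qed.

Lemma fib_le_pow2 d : (fib d <= 2 ^ d)%N.
Proof.
by elim/nat_ind2: d => // n IH1 IH2; rewrite fibSS !expnS; move: IH2; rewrite expnS; lia.
Qed.

(** The product of these primes divides F_d <= 2^d, and each factor exceeds 2^k. *)
Lemma card_large_primes_fib N k d : (0 < d)%N ->
  (k * #|[set p : 'I_N.+1 | [&& prime p, 2 ^ k < p & p %| fib d]%N]| <= d)%N.
Proof.
move=> d0; set X := [set p | _].
rewrite -(leq_exp2l _ _ (isT : 1 < 2)%N); apply: leq_trans (fib_le_pow2 d).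
apply: (@leq_trans (\prod_(p in X) p)%N).
  rewrite expnM -prod_nat_const; apply: leq_prod => p.
  by rewrite inE => /and3P[_ /ltnW].
rewrite dvdn_leq ?fib_gt0 // -big_enum -(big_map val xpredT id) /=.
rewrite dvdn_prod_primes.
- by rewrite all_map; apply/allP => p; rewrite mem_enum inE => /and3P[].
- by rewrite map_inj_uniq ?enum_uniq //; exact: val_inj.
- by rewrite all_map; apply/allP => p; rewrite mem_enum inE => /and3P[].
Qed.

Lemma card_primes_small_rank N k y :
  (k * #|[set p : 'I_N.+1 | [&& prime p, 2 ^ k < p
     & [exists d : 'I_y, p %| fib d.+1]]%N]| <= y * y)%N.
Proof.
set X := [set p | _].
have h : (#|X| <= \sum_(d < y) #|[set p : 'I_N.+1 | [&& prime p, 2 ^ k < p & p %| fib d.+1]%N]|)%N.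
  apply: (card_exists_le (r := fun d (p : 'I_N.+1) => [&& prime p, 2 ^ k < p & p %| fib d.+1]%N)) => p.
  rewrite inE => /and3P[pp kp /existsP[d pd]]; exists d; rewrite ?ltn_ord //.
  by rewrite pp kp.
apply: (leq_trans (leq_mul (leqnn k) h)); rewrite big_distrr /=.
apply: (@leq_trans (\sum_(d < y) y)%N); last by rewrite sum_nat_const card_ord.
apply: leq_sum => d _; apply: leq_trans (card_large_primes_fib _ _ _) _ => //.
Qed.

(** Unless some prime of Q divides both d and e, their counts add up. *)
Lemma divisor_pair_cases (Q : seq nat) (G d e : nat) :
  [\/ (omega_in Q d < G)%N, (omega_in Q e < G)%N,
      (exists2 q, q \in Q & (q * q %| d * e)%N) | (2 * G <= omega_in Q (d * e))%N].
Proof.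
have [?|Gd] := ltnP (omega_in Q d) G; first exact: Or41.
have [?|Ge] := ltnP (omega_in Q e) G; first exact: Or42.
have [/hasP[q qQ /andP[qd qe]]|no] := boolP (has (fun q => (q %| d)%N && (q %| e)%N) Q).
  by apply: Or43; exists q => //; rewrite dvdn_mul.
apply: Or44; have := count_predUI (dvdn^~ d) (dvdn^~ e) Q.
have -> : count (predI (dvdn^~ d) (dvdn^~ e)) Q = 0%N.
  by apply/eqP; rewrite -leqn0 leqNgt -has_count.
have : (count (predU (dvdn^~ d) (dvdn^~ e)) Q <= omega_in Q (d * e))%N.
  by apply: sub_count => q /= /orP[qd|qe]; [exact: dvdn_mulr | exact: dvdn_mull].
by move: Gd Ge; rewrite /omega_in; lia.
Qed.

(** * Counting the primes of each exceptional type *)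

Section MiddleRange.
Variables (R : realFieldType) (N k m H G L u : nat) (Q : seq nat).
Hypothesis k_gt0 : (0 < k)%N.
Hypothesis uQ : uniq Q.
Hypothesis pQ : all prime Q.

Local Notation A := (N%:R / k%:R : R).
Local Notation z := (2 ^ k)%N.
Local Notation W := (\prod_(q <- Q) (1 - (4 * q%:R)^-1) : R).

Let A_ge0 : 0 <= A. Proof. by rewrite divr_ge0. Qed.

(** Only d >= m / H occurs, so N/d is at most N H / m and comes out of the sum over d, leaving
    sigma(d)/d for [sum_inv_div_few]. *)
Lemma card_primes_few_divisor : (0 < m)%N -> (H * m <= 2 ^ L)%N ->
  #|[set p : 'I_N.+1 | prime p && [exists d : 'I_(H * m),
     [&& m <= d.+1 * H, omega_in Q d.+1 < G & d.+1 %| p.-1 + u]%N]]|%:R <=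
  4 * A * H%:R / m%:R * ((4/3) ^+ G * (2 * (H * m)%:R * W + (2 ^ size Q * L.+1)%:R))
  + 5 * (H * m)%:R * z%:R ^+ 4.
Proof.
move=> m0 HmL; set X := [set p | _].
have h : (#|X| <= \sum_(d < H * m) #|[set p : 'I_N.+1 | (m <= d.+1 * H)%N && (omega_in Q d.+1 < G)%N
     && (prime p && (d.+1 %| p.-1 + u)%N)]|)%N.
  apply: (card_exists_le (r := fun d (p : 'I_N.+1) => (m <= d.+1 * H)%N && (omega_in Q d.+1 < G)%N
     && (prime p && (d.+1 %| p.-1 + u)%N))) => p.
  rewrite inE => /andP[pp /existsP[d /and3P[h1 h2 h3]]]; exists d; rewrite ?ltn_ord //.
  by rewrite h1 h2 pp h3.
apply: (@le_trans _ _ (\sum_(d < H * m) #|[set p : 'I_N.+1 | (m <= d.+1 * H)%N && (omega_in Q d.+1 < G)%N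
     && (prime p && (d.+1 %| p.-1 + u)%N)]|%:R)).
  by rewrite -natr_sum ler_nat.
have mR : 0 < m%:R :> R by rewrite ltr0n.
have kR : 0 < k%:R :> R by rewrite ltr0n.
have s0 d : 0 <= sum_inv_div R d by apply: sumr_ge0 => a _; rewrite invr_ge0.
apply: (@le_trans _ _ (\sum_(d < H * m) ((if (omega_in Q d.+1 < G)%N then
    4 * A * H%:R / m%:R * sum_inv_div R d.+1 else 0) + 5 * z%:R ^+ 4))).
  apply: ler_sum => d _.
  have z4 : 0 <= 5 * z%:R ^+ 4 :> R by rewrite mulr_ge0 ?exprn_ge0.
  have [mdH|_] := leqP m (d.+1 * H); last first.
    have -> : [set p : 'I_N.+1 | false && (omega_in Q d.+1 < G)%N
      && (prime p && (d.+1 %| p.-1 + u)%N)] = set0 by apply/setP => p; rewrite !inE.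
    rewrite cards0 addr_ge0 //; case: ifP => // _.
    by rewrite !mulr_ge0 ?invr_ge0.
  case: ifP => _ /=; last first.
    have -> : [set p : 'I_N.+1 | false] = set0 by apply/setP => p; rewrite !inE.
    by rewrite cards0 add0r.
  apply: le_trans (primes_in_progression_le R u N (ltn0Sn d) k_gt0) _.
  rewrite lerD2r.
  have e : N%:R / d.+1%:R <= N%:R * H%:R / m%:R :> R.
    rewrite ler_pdivrMr ?ltr0n // mulrAC ler_pdivlMr // -mulrA ler_wpM2l //.
    by rewrite mulrC -natrM ler_nat.
  have -> : 4 * A * H%:R / m%:R * sum_inv_div R d.+1 =
     4 * sum_inv_div R d.+1 * (N%:R * H%:R / m%:R) / k%:R by ring.
  by rewrite ler_pM2r ?invr_gt0 // ler_wpM2l // mulr_ge0.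
rewrite big_split /= sumr_const card_ord; apply: lerD; last first.
  by rewrite -[leLHS]mulr_natr mulrAC.
rewrite -big_mkcond -mulr_sumr ler_wpM2l //.
exact: sum_inv_div_few.
Qed.

Hypothesis N_large : forall d, (d %| (\prod_(q <- Q) q) ^ 2)%N -> (z ^ 4 * k * d <= N)%N.

(** The 9 is 4 from the main term of the sieve plus 5 from its error 5 z^4, which [N_large] makes
    comparable. *)
Let progression_le d (s : R) : (0 < d)%N -> (z ^ 4 * k * d <= N)%N ->
  sum_inv_div R d <= s -> 1 <= s ->
  #|[set p : 'I_N.+1 | prime p && (d %| p.-1 + u)%N]|%:R <= 9 * A * (s / d%:R).
Proof.
move=> d0 dN ds s1; apply: le_trans (primes_in_progression_le R u N d0 k_gt0) _.
have kR : 0 < k%:R :> R by rewrite ltr0n.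
have dR : 0 < d%:R :> R by rewrite ltr0n.
have e1 : 4 * sum_inv_div R d * (N%:R / d%:R) / k%:R <= 4 * s * (N%:R / d%:R) / k%:R.
  by rewrite ler_pM2r ?invr_gt0 // ler_wpM2r ?divr_ge0 // ler_wpM2l.
have e2 : z%:R ^+ 4 <= A / d%:R :> R.
  by rewrite !ler_pdivlMr // -natrX -!natrM ler_nat mulnAC.
have e3 : A / d%:R <= A * (s / d%:R).
  by rewrite ler_wpM2l // -[leLHS]mul1r ler_pM2r ?invr_gt0.
have e4 : 4 * s * (N%:R / d%:R) / k%:R = 4 * (A * (s / d%:R)) by ring.
lra.
Qed.

Let prodQ_dvd T : uniq T -> {subset T <= Q} -> (\prod_(q <- T) q %| \prod_(q <- Q) q)%N.
Proof.
move=> uT sT; have pT : all prime T by apply/allP => q /sT /(allP pQ).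
rewrite dvdn_prod_primes //; apply/allP => q /sT qQ.
by rewrite (bigD1_seq q) //= dvdn_mulr.
Qed.

Lemma card_primes_square_divisor :
  #|[set p : 'I_N.+1 | prime p && has (fun q => q * q %| p.-1 + u)%N Q]|%:R <=
  27 * A * \sum_(q <- Q) (q%:R ^+ 2)^-1 :> R.
Proof.
have h : (#|[set p : 'I_N.+1 | prime p && has (fun q => q * q %| p.-1 + u)%N Q]| <=
   \sum_(q <- Q) #|[set p : 'I_N.+1 | prime p && (q * q %| p.-1 + u)%N]|)%N.
  elim: (Q) => [|q Q' IH] /=.
    by rewrite big_nil leqn0 cards_eq0; apply/eqP/setP => p; rewrite !inE andbF.
  rewrite big_cons; apply: leq_trans (leq_add (leqnn _) IH).
  apply: leq_trans (leq_card_setU _ _); apply: subset_leq_card.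
  by apply/subsetP => p; rewrite !inE => /andP[-> /orP[->|->]]; rewrite ?orbT.
apply: (@le_trans _ _ (\sum_(q <- Q) #|[set p : 'I_N.+1 | prime p && (q * q %| p.-1 + u)%N]|%:R)).
  by rewrite -natr_sum ler_nat.
rewrite mulr_sumr big_seq [leRHS]big_seq; apply: ler_sum => q qQ.
have pq : prime q := allP pQ _ qQ.
have qR : 2 <= q%:R :> R by rewrite ler_nat prime_gt1.
have qq : (q * q %| (\prod_(q <- Q) q) ^ 2)%N.
  by rewrite (bigD1_seq q) //= expnMn -mulnn dvdn_mulr.
have iq : q%:R^-1 <= 2^-1 :> R by rewrite lef_pV2 ?posrE //; lra.
have iq0 : 0 <= q%:R^-1 :> R by rewrite invr_ge0.
(* For d = q^2, sigma(d)/d <= (1 + 1/q)^2 <= 9/4, rounded up to 3. *)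
apply: le_trans (@progression_le _ 3 _ _ _ _) _.
- by rewrite muln_gt0 prime_gt0.
- exact: N_large.
- have := sum_inv_div_prod R (T := [:: q; q]); rewrite /= pq => /(_ isT).
  rewrite !big_cons !big_nil muln1 mulr1 => /le_trans; apply; nra.
- by lra.
by rewrite natrM expr2 le_eqVlt; apply/orP; left; apply/eqP; ring.
Qed.

Lemma card_primes_many_divisors :
  #|[set p : 'I_N.+1 | prime p && (2 * G <= omega_in Q (p.-1 + u))%N]|%:R <=
  9 * A * ((3/4) ^+ (2 * G) * \prod_(q <- Q) (1 + (1 + q%:R^-1) / q%:R / 3)) :> R.
Proof.
have K0 : 0 <= 9 * A by rewrite mulr_ge0.
have := primes_omega_moment (u := u) (N := N) uQ pQ K0.
set P := \prod_(q <- Q) _ => mom.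
have {}mom : \sum_(p < N.+1 | prime p) (4/3) ^+ omega_in Q (p.-1 + u) <= 9 * A * P.
  apply: mom => T uT sT.
  have pT : all prime T by apply/allP => q /sT /(allP pQ).
  rewrite prodf_div -natr_prod; apply: progression_le.
  - by rewrite big_seq prodn_cond_gt0 // => q qT; rewrite prime_gt0 // (allP pT).
  - by apply: N_large; rewrite expnS dvdn_mulr // prodQ_dvd.
  - exact: sum_inv_div_prod.
  - rewrite big_seq; apply: (big_ind (fun x : R => 1 <= x)) => // [x y|q _].
      by move=> x1 y1; rewrite mulr_ege1.
    by rewrite lerDl invr_ge0.
rewrite mulrCA.
apply: (@le_trans _ _ ((3/4) ^+ (2 * G) *
   \sum_(p < N.+1 | prime p) (4/3) ^+ omega_in Q (p.-1 + u))); last first.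
  by rewrite ler_wpM2l // exprn_ge0 //; lra.
rewrite -sum1_card natr_sum mulr_sumr.
under eq_bigl do rewrite inE.
rewrite big_mkcondr /=; apply: ler_sum => p _.
case: ifP => [Gp|_]; last by rewrite mulr_ge0 // exprn_ge0 //; lra.
rewrite -(subnKC Gp) exprD mulrA -exprMn.
have -> : 3/4 * (4/3) = 1 :> R by field.
by rewrite expr1n mul1r exprn_ege1 //; lra.
Qed.

End MiddleRange.

(** * Covering the exceptional primes *)

Definition small_rank (N D : nat) : {set 'I_N.+1} :=
  [set p : 'I_N.+1 | prime p & (p <= 5)%N || [exists d : 'I_D, p %| fib d.+1]%N].

Lemma card_primes_le N M : (M <= N)%N ->
  (#|[set p : 'I_N.+1 | prime p & (p <= M)%N]| <= #|[set p : 'I_M.+1 | prime p]|)%N.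
Proof.
move=> MN; have MN' : (M.+1 <= N.+1)%N by [].
apply: leq_trans (leq_imset_card (widen_ord MN') _); apply: subset_leq_card.
apply/subsetP => p; rewrite inE => /andP[pp pM].
apply/imsetP; exists (Ordinal (pM : (p < M.+1)%N)); first by rewrite inE.
exact: val_inj.
Qed.

(** As p > N/h, the product d e lies between about N/h and 4 m^2, so bounds for d pass to e. The 32
    comes from 16 (m + 1) <= 32 m; its doubling to 64 absorbs the shift from p to p - 1, by 2h <=
    m^2. *)
Lemma middle_factor_bounds h m N p u d e :
  (0 < h)%N -> (0 < m)%N -> (m * m <= N < m.+1 * m.+1)%N -> (2 * h <= m * m)%N ->
  (1 < p <= N)%N -> (N < p * h)%N -> (u <= 2)%N -> (p.-1 + u)%N = (d * e)%N ->
  (0 < d <= 32 * m)%N -> (m < d * h)%N ->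
  [/\ (0 < d <= 64 * h * m)%N, (m <= d * (64 * h))%N,
      (0 < e <= 64 * h * m)%N & (m <= e * (64 * h))%N].
Proof.
move=> h0 m0 /andP[mN Nm] mh /andP[p1 pN] hp u2 ne /andP[d0 dm] dh.
have n_le : (d * e <= 4 * (m * m))%N.
  apply: (@leq_trans (m.+1 * m.+1)).
    rewrite -ne; apply: leq_trans Nm; apply: (@leq_trans (p.-1 + 2)); first by rewrite leq_add2l.
    by rewrite addn2 prednK ?(ltnW p1).
  have m2 : (m.+1 <= 2 * m)%N by rewrite mul2n -addnn -addn1 leq_add2l.
  by apply: leq_trans (leq_mul m2 m2) _; rewrite mulnACA.
have n_ge : (p.-1 <= d * e)%N by rewrite -ne leq_addr.
have e0 : (0 < e)%N.
  rewrite lt0n; apply: contraTneq n_ge => ->; rewrite muln0 leqn0.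
  by rewrite -lt0n -subn1 subn_gt0.
split.
- rewrite d0 /=; apply: (leq_trans dm); rewrite leq_mul2r; apply/orP; right.
  by apply: leq_trans (leq_pmulr _ h0).
- by apply: leq_trans (ltnW dh) _; rewrite leq_mul2l leq_pmull ?orbT.
- rewrite e0 /=; have : (e * m <= (4 * h * m) * m)%N.
    apply: (@leq_trans (e * (d * h))); first by rewrite leq_mul2l ltnW ?orbT.
    have -> : (e * (d * h) = d * e * h)%N by rewrite mulnA [(e * d)%N]mulnC.
    by apply: leq_trans (leq_mul n_le (leqnn h)) _; rewrite -[(4 * h * m * m)%N]mulnA mulnAC.
  rewrite leq_pmul2r // => /leq_trans; apply.
  by rewrite leq_mul2r leq_mul2r !orbT.
have h1 : (p.-1 * h <= 32 * m * e * h)%N.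
  by rewrite leq_mul2r; apply/orP; right; apply: (leq_trans n_ge); rewrite leq_mul2r dm orbT.
have h2 : (m * m < p.-1 * h + h)%N.
  by apply: (leq_ltn_trans mN); apply: (leq_trans hp); rewrite -mulSnr prednK // ltnW.
have : (m * m <= (e * (64 * h)) * m)%N.
  clear -h1 h2 mh; move: (p.-1 * h)%N h1 h2 => y h1 h2; lia.
by rewrite leq_pmul2r.
Qed.

Section Cover.
Variables (N m h k G : nat) (Q : seq nat).
Hypothesis m_sqr : (m * m <= N < m.+1 * m.+1)%N.
Hypothesis h_gt0 : (0 < h)%N.
Hypothesis m_large : (2 * h <= m * m)%N.
Hypothesis z_large : (5 <= 2 ^ k)%N.

Local Notation H := (64 * h)%N.

Definition middle_few u : {set 'I_N.+1} := [set p : 'I_N.+1 | prime p &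
  [exists d : 'I_(H * m), [&& m <= d.+1 * H, omega_in Q d.+1 < G & d.+1 %| p.-1 + u]%N]].
Definition middle_square u : {set 'I_N.+1} :=
  [set p : 'I_N.+1 | prime p && has (fun q => q * q %| p.-1 + u)%N Q].
Definition middle_many u : {set 'I_N.+1} :=
  [set p : 'I_N.+1 | prime p && (2 * G <= omega_in Q (p.-1 + u))%N].
Definition middle u := middle_few u :|: middle_square u :|: middle_many u.

Lemma small_rank_cover : small_rank N (16 * m.+1) \subset
  [set p : 'I_N.+1 | prime p & (p <= 2 ^ k)%N] :|: [set p : 'I_N.+1 | prime p & (p <= N %/ h)%N] :|:
  [set p : 'I_N.+1 | [&& prime p, 2 ^ k < p & [exists d : 'I_(m %/ h), p %| fib d.+1]]%N]
  :|: middle 0 :|: middle 2.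
Proof.
apply/subsetP => p; rewrite 4!in_setU inE => /andP[pp].
have [pz|zp] := leqP p (2 ^ k).
  by have -> : p \in [set p : 'I_N.+1 | prime p & (p <= 2 ^ k)%N] by rewrite inE pp pz.
have p5 : (5 < p)%N by lia.
rewrite leqNgt p5 /= => /existsP[d0 pd0].
have [ph|hp] := leqP p (N %/ h).
  have -> : p \in [set p : 'I_N.+1 | prime p & (p <= N %/ h)%N] by rewrite inE pp ph.
  by rewrite orbT.
have m0 : (0 < m)%N by nia.
have p2 : (2 < p)%N by lia. have p5' : (p != 5 :> nat)%N by lia.
have [d /andP[d1 d2] [pd dn]] := dvdn_fib_rank pp p2 p5' (ltn0Sn d0) pd0.
have dm : (d <= 32 * m)%N.
  apply: leq_trans d2 (leq_trans (ltn_ord d0) _).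
  by rewrite -[(32 * m)%N]/((16 * 2) * m)%N -mulnA leq_mul2l /= mul2n -addnn -addn1 leq_add2l.
have dE : d.-1.+1 = d := prednK d1.
have [dh|dh] := leqP d (m %/ h).
  have dh' : (d.-1 < m %/ h)%N by rewrite dE.
  suff -> : p \in [set p : 'I_N.+1 | [&& prime p, 2 ^ k < p &
     [exists d : 'I_(m %/ h), p %| fib d.+1]]%N] by rewrite orbT.
  by rewrite inE pp zp; apply/existsP; exists (Ordinal dh'); rewrite /= dE.
move: dh hp; rewrite !ltn_divLR // => dh hp.
suff mid u : (u <= 2)%N -> (d %| p.-1 + u)%N -> p \in middle u.
  case: dn => dn.
    by have /(_ _)-> := mid 0%N isT; rewrite ?orbT ?addn0.
  by rewrite (mid 2) ?orbT //; have -> : (p.-1 + 2 = p.+1)%N by lia.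
move=> u2 /dvdnP[e ne]; rewrite mulnC in ne.
have pN : (p <= N)%N by rewrite -ltnS.
have few x : (0 < x <= H * m)%N -> (m <= x * H)%N -> (omega_in Q x < G)%N ->
    (x %| p.-1 + u)%N -> p \in middle u.
  move=> /andP[x0 xH] mx xG xn; rewrite !inE pp /=.
  have xH' : (x.-1 < H * m)%N by rewrite prednK.
  suff -> : [exists d : 'I_(H * m), [&& m <= d.+1 * H, omega_in Q d.+1 < G & d.+1 %| p.-1 + u]%N] by [].
  apply/existsP; exists (Ordinal xH'); rewrite /= prednK //.
  by rewrite mx xG.
have pN' : (1 < p <= N)%N by rewrite prime_gt1.
have d1' : (0 < d <= 32 * m)%N by rewrite d1.
have [b1 b2 b3 b4] := middle_factor_bounds h_gt0 m0 m_sqr m_large pN' hp u2 ne d1' dh.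
case: (divisor_pair_cases Q G d e) => [dG|eG|[q qQ qde]|Gde].
- by apply: few dG _ => //; rewrite ne dvdn_mulr.
- by apply: few eG _ => //; rewrite ne dvdn_mull.
- rewrite !inE pp /=; suff -> : has (fun q => q * q %| p.-1 + u)%N Q by rewrite ?orbT.
  by apply/hasP; exists q => //; rewrite ne.
- by rewrite !inE pp /= ne Gde ?orbT.
Qed.

End Cover.

Lemma isqrt_exists N : exists m, (m * m <= N < m.+1 * m.+1)%N.
Proof.
elim: N => [|N [m /andP[h1 h2]]]; first by exists 0%N.
have [h|h] := ltnP N.+1 (m.+1 * m.+1); first by exists m; rewrite h andbT leqW.
by exists m.+1; rewrite h /=; nia.
Qed.

Lemma linear_le_pow2 c k : (4 * c <= k)%N -> (c * k.+1 <= 2 ^ k)%N.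
Proof.
move=> ck; set j := (k %/ 2)%N.
have kj : (2 * j <= k < 2 * j + 2)%N by rewrite /j; lia.
have hj : (j.+1 <= 2 ^ j)%N by apply: ltn_expl.
have : (2 ^ (2 * j) <= 2 ^ k)%N by rewrite leq_exp2l //; case/andP: kj.
by rewrite mulnC expnM -mulnn; nia.
Qed.

(** N <= 2 (100k + 100) a + 1 <= (200 + 200 + 1) a k. *)
Lemma half_le_mul N k a : (2 <= N)%N -> (0 < k)%N ->
  (N %/ 2 <= (100 * k + 100) * a)%N -> (N <= 401 * a * k)%N.
Proof.
move=> N2 k0; set q := (N %/ 2)%N => h.
have Nq : (N <= 2 * q + 1)%N by rewrite /q; lia.
have q1 : (1 <= q)%N by rewrite /q; lia.
have a1 : (1 <= a)%N by case: a h => // h; lia.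
have ak : (a <= a * k)%N by rewrite leq_pmulr.
lia.
Qed.

Lemma ratio_le_prime_pi (R : realFieldType) N k : (2 <= N)%N -> (0 < k)%N ->
  (N < 2 ^ (100 * k + 100))%N -> N%:R / k%:R <= 401 * (prime_pi N)%:R :> R.
Proof.
move=> N2 k0 /chebyshev_lower; rewrite -/(prime_pi N) => h.
by rewrite ler_pdivrMr ?ltr0n // -!natrM ler_nat; exact: half_le_mul.
Qed.

(** * Adding up the counts at level z = 2^k *)

Section SmallRank.
Variables (R : realType) (N m h k G c : nat) (Q : seq nat) (tau tau' : R).
Hypothesis m_sqr : (m * m <= N < m.+1 * m.+1)%N.
Hypothesis h_gt0 : (0 < h)%N.
Hypothesis k_gt0 : (0 < k)%N.
Hypothesis kN : (2 ^ (100 * k) <= N < 2 ^ (100 * k + 100))%N.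
Hypothesis uQ : uniq Q.
Hypothesis pQ : all prime Q.
Hypothesis tau_sqr : \sum_(q <- Q) (q%:R ^+ 2)^-1 <= tau.
Hypothesis tau_few : (4/3) ^+ G * \prod_(q <- Q) (1 - (4 * q%:R)^-1) <= tau.
Hypothesis tau_many :
  (3/4) ^+ (2 * G) * \prod_(q <- Q) (1 + (1 + q%:R^-1) / q%:R / 3) <= tau.
Hypothesis tau'_gt0 : 0 < tau'.
(** [c] dominates every quantity that does not depend on N; this makes it negligible against z even
    after multiplication by k, that is by log N. *)
Hypothesis c_pow2 : (c * k.+1 <= 2 ^ k)%N.
Hypothesis c5 : (5 <= c)%N.
Hypothesis ch : (64 * h <= c)%N.
Hypothesis cQ : ((\prod_(q <- Q) q) ^ 2 <= c)%N.
Hypothesis c_tau' :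
  204 * (64 * h)%:R * (4/3) ^+ G * (2 ^ size Q)%:R / tau' + 7 / tau' + 5 * (64 * h)%:R / tau' <= c%:R.

Local Notation z := (2 ^ k)%N.
Local Notation H := (64 * h)%N.
Local Notation A := (N%:R / k%:R : R).

Let cz : (c <= z)%N. Proof. by apply: leq_trans c_pow2; rewrite leq_pmulr. Qed.
Let ckz : (c * k <= z)%N. Proof. by apply: leq_trans c_pow2; rewrite leq_mul2l leqnSn orbT. Qed.
Let z0 : (0 < z)%N. Proof. by rewrite expn_gt0. Qed.

Let mz : (z ^ 50 <= m)%N.
Proof.
have /andP[_ h1] := m_sqr; have /andP[h2 _] := kN.
have e : (2 ^ (100 * k) = z ^ 50 * z ^ 50)%N by rewrite -expnD -expnM mulnC.
rewrite -ltnS ltnNge; apply/negP => h3.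
by have := leq_trans h1 (leq_mul h3 h3); rewrite -e => /leq_trans/(_ h2); rewrite ltnn.
Qed.

Let mz5 : (z ^ 5 <= m)%N.
Proof. by apply: leq_trans mz; rewrite leq_pexp2l. Qed.

Let m_ge_z : (z <= m)%N.
Proof. by apply: leq_trans mz5; rewrite -{1}(expn1 z) leq_pexp2l. Qed.

Let mL : (H * m <= 2 ^ (51 * k + 50))%N.
Proof.
have /andP[h1 _] := m_sqr; have /andP[_ h2] := kN.
have hm : (m < 2 ^ (50 * k + 50))%N.
  rewrite ltnNge; apply/negP => h3; have := leq_mul h3 h3.
  have e : (50 * k + 50 + (50 * k + 50) = 100 * k + 100)%N by lia.
  by rewrite -expnD e => /leq_trans/(_ h1); rewrite leqNgt h2.
have -> : (2 ^ (51 * k + 50) = z * 2 ^ (50 * k + 50))%N by rewrite -expnD; congr (2 ^ _)%N; lia.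
by rewrite leq_mul ?(ltnW hm) // (leq_trans ch).
Qed.

Let mN : (m <= N)%N.
Proof.
have /andP[h1 _] := m_sqr; apply: leq_trans h1.
by rewrite leq_pmulr // (leq_trans z0 m_ge_z).
Qed.

Let kR : 0 < k%:R :> R. Proof. by rewrite ltr0n. Qed.
Let hR : 0 < h%:R :> R. Proof. by rewrite ltr0n. Qed.
Let mR : 0 < m%:R :> R. Proof. by rewrite ltr0n (leq_trans z0). Qed.
Let NR : 0 < N%:R :> R. Proof. by rewrite ltr0n (leq_trans z0) // (leq_trans m_ge_z). Qed.
Let A_gt0 : 0 < A. Proof. by rewrite divr_gt0. Qed.

Let term x : 0 <= x -> x / tau' <= c%:R -> x * k%:R <= tau' * z%:R.
Proof.
move=> x0; rewrite ler_pdivrMr // => xc.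
apply: (@le_trans _ _ (c%:R * tau' * k%:R)); first by rewrite ler_wpM2r // ltW.
by rewrite mulrAC mulrC ler_pM2l // -natrM ler_nat.
Qed.

Let nonneg : [/\ 0 <= 204 * H%:R * (4/3) ^+ G * (2 ^ size Q)%:R / tau',
  0 <= 7 / tau' & 0 <= 5 * H%:R / tau'].
Proof.
by split; apply: divr_ge0 (ltW tau'_gt0); rewrite ?mulr_ge0 ?ler0n ?exprn_ge0 ?divr_ge0 ?ler0n.
Qed.

Let c_ge : [/\ 204 * H%:R * (4/3) ^+ G * (2 ^ size Q)%:R / tau' <= c%:R,
  7 / tau' <= c%:R & 5 * H%:R / tau' <= c%:R].
Proof.
case: nonneg; move: c_tau'.
move: (204 * H%:R * (4/3) ^+ G * (2 ^ size Q)%:R / tau') (7 / tau') (5 * H%:R / tau').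
by move=> x y t *; split; lra.
Qed.

Let z4_le : 7 * z%:R ^+ 4 <= tau' * A.
Proof.
rewrite [leRHS]mulrA ler_pdivlMr // mulrAC.
have [_ h7 _] := c_ge.
apply: (@le_trans _ _ (tau' * z%:R * z%:R ^+ 4)).
  by rewrite ler_wpM2r ?exprn_ge0 // term.
rewrite -mulrA -exprS ler_pM2l // -natrX ler_nat.
exact: leq_trans mz5 mN.
Qed.

Let Hm_le : 5 * (H * m)%:R * z%:R ^+ 4 <= tau' * A.
Proof.
rewrite [leRHS]mulrA ler_pdivlMr // natrM.
have [_ _ h5] := c_ge.
have -> : 5 * (H%:R * m%:R) * z%:R ^+ 4 * k%:R = 5 * H%:R * k%:R * z%:R ^+ 4 * m%:R :> R by ring.
apply: (@le_trans _ _ (tau' * z%:R * z%:R ^+ 4 * m%:R)).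
  by rewrite ler_pM2r // ler_wpM2r ?exprn_ge0 // term // mulr_ge0.
have -> : tau' * z%:R * z%:R ^+ 4 * m%:R = tau' * (z%:R ^+ 5 * m%:R) by ring.
rewrite ler_pM2l // -natrX -natrM ler_nat.
by have /andP[h1 _] := m_sqr; apply: leq_trans h1; rewrite leq_mul2r mz5 orbT.
Qed.

Let few_le u : #|middle_few N m h G Q u|%:R <= 8 * H%:R ^+ 2 * tau * A + 2 * tau' * A.
Proof.
have m0 : (0 < m)%N by rewrite -(ltr0n R).
(* L + 1 = 51 (k + 1) is the origin of 204 = 4 * 51. *)
have [L LE HmL] : exists2 L, L.+1 = (51 * k.+1)%N & (H * m <= 2 ^ L)%N.
  by exists (51 * k + 50)%N; [rewrite -addnS mulnS addnC | exact: mL].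
apply: le_trans (card_primes_few_divisor R N G u k_gt0 uQ pQ m0 HmL) _.
have := tau_few; set W := \prod_(q <- Q) _ => few.
have -> : 4 * A * H%:R / m%:R *
   ((4 / 3) ^+ G * (2 * (H * m)%:R * W + (2 ^ size Q * L.+1)%:R)) =
   8 * H%:R ^+ 2 * A * ((4/3) ^+ G * W) +
   (4 * H%:R * (4/3) ^+ G * (2 ^ size Q)%:R * (L.+1)%:R / m%:R) * A.
  by rewrite !natrM; field; rewrite !gt_eqF.
have e1 : 8 * H%:R ^+ 2 * A * ((4/3) ^+ G * W) <= 8 * H%:R ^+ 2 * tau * A.
  rewrite [leRHS]mulrAC ler_wpM2l // !mulr_ge0 ?exprn_ge0 //; exact: ltW.
have e2 : 4 * H%:R * (4/3) ^+ G * (2 ^ size Q)%:R * (L.+1)%:R / m%:R <= tau'.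
  rewrite ler_pdivrMr //; have [hc _ _] := c_ge.
  rewrite ler_pdivrMr // in hc.
  rewrite LE [(51 * k.+1)%:R]natrM.
  have -> : 4 * H%:R * (4 / 3) ^+ G * (2 ^ size Q)%:R * (51 * k.+1%:R) =
     204 * H%:R * (4 / 3) ^+ G * (2 ^ size Q)%:R * k.+1%:R :> R by ring.
  apply: (@le_trans _ _ (c%:R * tau' * k.+1%:R)); first by rewrite ler_pM2r.
  rewrite mulrAC mulrC ler_pM2l // -natrM ler_nat.
  exact: leq_trans c_pow2 m_ge_z.
have e3 : 4 * H%:R * (4/3) ^+ G * (2 ^ size Q)%:R * (L.+1)%:R / m%:R * A <= tau' * A.
  by rewrite ler_pM2r.
have e4 := Hm_le.
lra.
Qed.

Let N_large d : (d %| (\prod_(q <- Q) q) ^ 2)%N -> (z ^ 4 * k * d <= N)%N.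
Proof.
move=> /dvdn_leq dQ.
have Q0 : (0 < \prod_(q <- Q) q)%N.
  by rewrite big_seq prodn_cond_gt0 // => q qQ; rewrite prime_gt0 // (allP pQ).
have {}dQ : (d <= c)%N by apply: leq_trans (dQ _) cQ; rewrite expn_gt0 Q0.
apply: leq_trans (leq_trans mz5 mN).
rewrite [(z ^ 5)%N]expnSr -mulnA leq_mul2l.
by rewrite mulnC (leq_trans _ ckz) ?orbT // leq_mul2r dQ orbT.
Qed.

Let middle_le u : #|middle N m h G Q u|%:R <= (8 * H%:R ^+ 2 * tau + 36 * tau + 2 * tau') * A.
Proof.
have e1 := few_le u.
have e2 := card_primes_square_divisor R u k_gt0 uQ pQ N_large.
have e3 := card_primes_many_divisors R G u k_gt0 uQ pQ N_large.
have c1 : (#|middle N m h G Q u| <= #|middle_few N m h G Q u| +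
    #|middle_square N Q u| + #|middle_many N G Q u|)%N.
  apply: leq_trans (leq_card_setU _ _) _; rewrite leq_add2r; exact: leq_card_setU.
move: c1; rewrite -(ler_nat R) !natrD => c1.
have e4 : 27 * A * \sum_(q <- Q) (q%:R ^+ 2)^-1 <= 27 * A * tau.
  by rewrite ler_pM2l // mulr_gt0.
have e5 : 9 * A * ((3/4) ^+ (2 * G) * \prod_(q <- Q) (1 + (1 + q%:R^-1) / q%:R / 3)) <= 9 * A * tau.
  by rewrite ler_pM2l // mulr_gt0.
rewrite /middle_square /middle_many in c1.
lra.
Qed.

(** 5/h is 4/h from the primes up to N/h plus 1/h from small d. The sets [middle 0] and [middle 2]
    account for the terms in tau and for 4 tau'; the fifth tau' covers 7 z^4, of which 2 z^4 for the
    primes up to z and 5 z^4 for the sieve error. *)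
Lemma card_small_rank_le : #|small_rank N (16 * m.+1)|%:R <=
  (5 / h%:R + 16 * H%:R ^+ 2 * tau + 72 * tau + 5 * tau') * A.
Proof.
have z5 : (5 <= z)%N by apply: leq_trans cz.
have mh : (2 * h <= m * m)%N.
  apply: (@leq_trans m); last by rewrite leq_pmulr // -(ltr0n R).
  by apply: leq_trans (leq_trans cz m_ge_z); apply: leq_trans ch; rewrite leq_mul2r orbT.
have := subset_leq_card (small_rank_cover G Q m_sqr h_gt0 mh z5).
set X0 := [set p : 'I_N.+1 | prime p & (p <= z)%N].
set X1 := [set p : 'I_N.+1 | prime p & (p <= N %/ h)%N].
set X2 := [set p : 'I_N.+1 | [&& _, _ & _]] => cover.
have c0 : (#|X0| <= z.+1)%N.
  apply: leq_trans (card_primes_le (leq_trans m_ge_z mN)) _.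
  by apply: leq_trans (max_card _) _; rewrite card_ord.
have c1 : #|X1|%:R <= 4 / h%:R * A + 5 * z%:R ^+ 4.
  have h1 := card_primes_le (leq_div N h).
  have := primes_in_progression_le R 0 (N %/ h) (isT : 0 < 1)%N k_gt0.
  have -> : [set p : 'I_(N %/ h).+1 | prime p && (1 %| p.-1 + 0)%N] =
     [set p : 'I_(N %/ h).+1 | prime p] by apply/setP => p; rewrite !inE dvd1n andbT.
  rewrite sum_inv_div1 mulr1 divr1 => h2.
  apply: (@le_trans _ _ #|[set p : 'I_(N %/ h).+1 | prime p]|%:R); first by rewrite ler_nat.
  apply: (le_trans h2); rewrite lerD2r -mulrA -[leRHS]mulrA ler_pM2l //.
  rewrite mulrA ler_pM2r ?invr_gt0 // mulrC ler_pdivlMr // -natrM ler_nat.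
  exact: leq_trunc_div.
have c2 : #|X2|%:R <= h%:R^-1 * A.
  have := card_primes_small_rank N k (m %/ h) => h1.
  have h2 : (k * #|X2| * h <= N)%N.
    have /andP[h3 _] := m_sqr; apply: leq_trans h3.
    apply: (@leq_trans (m %/ h * (m %/ h) * h)); first by rewrite leq_mul2r h1 orbT.
    by rewrite -mulnA leq_mul ?leq_div ?leq_trunc_div.
  rewrite mulrC !ler_pdivlMr // -!natrM ler_nat.
  by apply: leq_trans h2; rewrite mulnC mulnA.
have m0 := middle_le 0; have m2 := middle_le 2.
have ctot : (#|small_rank N (16 * m.+1)| <= #|X0| + #|X1| + #|X2| +
    #|middle N m h G Q 0| + #|middle N m h G Q 2|)%N.
  apply: (leq_trans cover).
  do 3 (apply: leq_trans (leq_card_setU _ _) _; rewrite leq_add2r).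
  exact: leq_card_setU.
move: ctot; rewrite -(ler_nat R) !natrD => ctot.
have {}c0 : #|X0|%:R <= 2 * z%:R ^+ 4 :> R.
  rewrite -natrX -natrM ler_nat; apply: (leq_trans c0).
  have z4 : (z <= z ^ 4)%N by rewrite -{1}(expn1 z) leq_pexp2l.
  by rewrite -addn1 mul2n -addnn leq_add // expn_gt0 z0.
have z7 := z4_le.
have -> : 5 / h%:R = 4 / h%:R + h%:R^-1 :> R by field; rewrite gt_eqF.
lra.
Qed.

End SmallRank.

(** * Letting N tend to infinity *)

Lemma trunc_log2_window N (k := (trunc_log 2 N %/ 100)%N) : (0 < N)%N ->
  (2 ^ (100 * k) <= N < 2 ^ (100 * k + 100))%N.
Proof.
move=> N0; have le k' : (2 ^ (100 * k) <= 2 ^ k')%N = (100 * k <= k')%N by rewrite leq_exp2l.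
apply/andP; split.
  apply: leq_trans (trunc_logP (isT : 1 < 2)%N N0).
  by rewrite le mulnC leq_trunc_div.
apply: leq_trans (trunc_log_ltn N (isT : 1 < 2)%N) _.
by rewrite leq_exp2l // /k; lia.
Qed.

(** Order of choices: h makes 5/h small, tau is small relative to h, Q and G depend on tau, and c on
    all of these. Each of the three groups of terms gets a third of delta/401, the 401 being the
    loss in [ratio_le_prime_pi]. *)
Lemma small_rank_negligible (R : realType) (delta : R) : 0 < delta ->
  exists N0, forall N, (N0 <= N)%N -> exists2 m, (m * m <= N < m.+1 * m.+1)%N &
    #|small_rank N (16 * m.+1)|%:R <= delta * (prime_pi N)%:R.
Proof.
move=> d0.
have p401 : 0 < 401 :> R by rewrite ltr0n.
have p15 : 0 < 15 :> R by rewrite ltr0n.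
have p3 : 0 < 3 :> R by rewrite ltr0n.
pose d1 := delta / 401; have d10 : 0 < d1 := divr_gt0 d0 p401.
pose h := (Num.bound (15 / d1)).+1.
have hR : 0 < h%:R :> R by rewrite ltr0n.
have hd : 5 / h%:R <= d1 / 3.
  have : 15 / d1 < h%:R.
    apply: lt_le_trans (archi_boundP _) _; first by rewrite divr_ge0 // ltW.
    by rewrite ler_nat.
  by rewrite ltr_pdivrMr // ler_pdivrMr //; nra.
pose H := (64 * h)%N.
pose tau := d1 / 3 / (16 * H%:R ^+ 2 + 72).
have den : 0 < 16 * H%:R ^+ 2 + 72 :> R by rewrite ltr_wpDl // mulr_ge0 ?exprn_ge0.
have tau0 : 0 < tau := divr_gt0 (divr_gt0 d10 p3) den.
have tauE : 16 * H%:R ^+ 2 * tau + 72 * tau = d1 / 3.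
  by rewrite -mulrDl /tau mulrC divfK // gt_eqF.
pose tau' := d1 / 15; have tau'0 : 0 < tau' := divr_gt0 d10 p15.
have [Q [G [uQ pQ Q1 Q2 Q3]]] := choice_of_primes tau0.
pose x := 204 * H%:R * (4/3) ^+ G * (2 ^ size Q)%:R / tau' + 7 / tau' + 5 * H%:R / tau'.
pose c := (5 + H + (\prod_(q <- Q) q) ^ 2 + Num.bound x)%N.
have xc : x <= c%:R.
  apply: (@le_trans _ _ (Num.bound x)%:R); last by rewrite ler_nat leq_addl.
  by apply/ltW/archi_boundP; rewrite !addr_ge0 ?divr_ge0 ?(ltW tau'0) ?mulr_ge0 ?ler0n ?exprn_ge0 ?(ltW d0).
pose k0 := (4 * c)%N.
exists (2 ^ (100 * k0))%N => N NN0.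
have [m m_sqr] := isqrt_exists N; exists m => //.
pose k := (trunc_log 2 N %/ 100)%N.
have N0 : (0 < N)%N by apply: leq_trans NN0; rewrite expn_gt0.
have kN := trunc_log2_window N0.
have kk0 : (k0 <= k)%N.
  by rewrite /k leq_divRL // mulnC; apply: trunc_log_max.
have c5 : (5 <= c)%N by rewrite /c -!addnA leq_addr.
have k00 : (0 < k0)%N by rewrite /k0 muln_gt0 /= (leq_trans _ c5).
have k1 : (0 < k)%N := leq_trans k00 kk0.
have ck := linear_le_pow2 kk0.
have ch : (64 * h <= c)%N by rewrite /c -!addnA addnCA leq_addr.
have cQ : ((\prod_(q <- Q) q) ^ 2 <= c)%N by rewrite /c addnAC leq_addl.
have h0 : (0 < h)%N by [].
have b1 := card_small_rank_le m_sqr h0 k1 kN uQ pQ Q1 Q2 Q3 tau'0 ck c5 ch cQ xc.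
have N2 : (2 <= N)%N.
  by apply: leq_trans NN0; rewrite -{1}(expn1 2) leq_exp2l // muln_gt0 k00.
have b2 := ratio_le_prime_pi R N2 k1 (proj2 (andP kN)).
apply: (le_trans b1); rewrite -/H.
have -> : delta = d1 * 401 by rewrite /d1; field.
have A0 : 0 <= N%:R / k%:R :> R by rewrite divr_ge0.
apply: (@le_trans _ _ (d1 * (N%:R / k%:R))).
  have t5 : 5 * tau' = d1 / 3 by rewrite /tau'; field.
  rewrite ler_wpM2r // -[X in X + 5 * _]addrA tauE t5.
  by apply: (@le_trans _ _ (d1 / 3 + d1 / 3 + d1 / 3)); [rewrite !lerD | lra].
by rewrite -mulrA ler_pM2l.
Qed.

(** Take I = 2 (m + 1): then I^2 = 4 (m + 1)^2 >= 2p, while 6I = 12 (m + 1) and 8I = 16 (m + 1). *)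
Lemma prime_good_or_small_rank (R : realType) (N m : nat) (B : R) :
  (m * m <= N < m.+1 * m.+1)%N -> (12 * m.+1)%:R <= B ->
  (prime_pi N <= good_count N B + #|small_rank N (16 * m.+1)|)%N.
Proof.
move=> /andP[mN Nm] mB.
apply: leq_trans (leq_card_setU _ _); apply: subset_leq_card.
apply/subsetP => p; rewrite !inE => pp; rewrite pp /=.
have [//|] := boolP ((p <= 5)%N || _); first by rewrite orbT.
rewrite orbF negb_or -ltnNge => /andP[p5 /existsPn rk].
apply/asboolP; apply: (@good16_fib_rank R p (2 * m.+1)) => //.
- by have := ltn_ord p; nia.
- move=> j /andP[j0 jm].
  have jm' : (j.-1 < 16 * m.+1)%N by lia.
  by have := rk (Ordinal jm'); rewrite /= prednK.
- by rewrite mulnA.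
Qed.

Lemma powR_half_ln (R : realType) (N : nat) (c : R) : (1 < N)%N -> 0 < c ->
  (N%:R : R) `^ (2^-1 + ln c / ln N%:R) = c * Num.sqrt N%:R.
Proof.
move=> N1 c0; have N0 : 0 < N%:R :> R by rewrite ltr0n ltnW.
have lN : ln N%:R != 0 :> R by rewrite gt_eqF // ln_gt0 // ltr1n.
rewrite powRD ?(gt_eqF N0) ?implybT // powR12_sqrt ?ltW // mulrC; congr (_ * _).
by rewrite /powR gt_eqF // divfK // lnK.
Qed.

Local Open Scope classical_set_scope.
Local Open Scope ring_scope.

Lemma cvg_inv_ln (R : realType) (c : R) :
  (fun N : nat => c / ln (N%:R : R)) @ \oo --> (0 : R).
Proof.
apply/cvgrPdist_le => e e0.
near=> N.
have lN : `|c| / e < ln N%:R.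
  rewrite -[ltLHS]expRK ltr_ln ?posrE ?expR_gt0 //.
    by near: N; exact: nbhs_infty_gtr.
  by rewrite ltr0n; near: N; exact: nbhs_infty_gt.
have l0 : 0 < ln N%:R :> R by apply: le_lt_trans lN; rewrite divr_ge0 // ltW.
rewrite sub0r normrN normrM normfV (gtr0_norm l0) ler_pdivrMr // mulrC.
by rewrite -ler_pdivrMr // ltW.
Unshelve. all: by end_near. Qed.

Theorem theorem3 (R : realType) :
  exists eps : nat -> R,
    eps @ \oo --> (0 : R) /\
    (fun N : nat =>
       (good_count N ((N%:R : R) `^ (2^-1 + eps N)))%:R / (prime_pi N)%:R : R)
      @ \oo --> (1 : R).
Proof.
(* This makes N^(1/2 + eps) equal to 24 sqrt N, which suffices since 12 (m + 1) <= 24 m <= 24 sqrt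
   N. *)
exists (fun N => ln 24 / ln N%:R); split; first exact: cvg_inv_ln.
apply/cvgrPdist_le => e e0.
have [N0 hN0] := small_rank_negligible e0.
near=> N.
have N1 : (1 < N)%N by near: N; exact: nbhs_infty_gt.
have NN0 : (N0 <= N)%N by near: N; exact: nbhs_infty_ge.
have [m m_sqr small] := hN0 N NN0.
rewrite powR_half_ln //; set B := 24 * _.
have [mN Nm] := andP m_sqr.
have mB : (12 * m.+1)%:R <= B.
  have ms : m%:R <= Num.sqrt N%:R :> R.
    by rewrite -[leLHS](ger0_norm (ler0n R m)) -sqrtr_sqr ler_wsqrtr // -natrX ler_nat -mulnn.
  have m1 : (1 <= m)%N by nia.
  have : 1 <= m%:R :> R by rewrite ler1n.
  rewrite natrM -natr1 /B; lra.
have cover := prime_good_or_small_rank m_sqr mB.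
have le : (good_count N B <= prime_pi N)%N.
  by apply: subset_leq_card; apply/fintype.subsetP => p; rewrite !inE => /andP[].
have pi0 : 0 < (prime_pi N)%:R :> R.
  rewrite ltr0n; apply/card_gt0P; exists (inord 2); rewrite inE inordK //.
rewrite distrC ler_norml.
have -> : (good_count N B)%:R / (prime_pi N)%:R - 1 =
   - (((prime_pi N)%:R - (good_count N B)%:R) / (prime_pi N)%:R) :> R.
  by field; rewrite gt_eqF.
move: cover le; rewrite -!(ler_nat R) natrD => cover le.
rewrite lerN2 ler_pdivrMr //; apply/andP; split; first lra.
apply: (@le_trans _ _ 0); last exact: ltW.
by rewrite oppr_le0 divr_ge0 // ?subr_ge0 // ltW.
Unshelve. all: by end_near. Qed.
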